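(* Let $\lambda=(\lambda_1,\ldots,\lambda_r)$ with $\lambda_1>\cdots>\lambda_r\ge 0$ and $\mu=(\mu_1,\ldots,\mu_s)$ with $\mu_1>\cdots>\mu_s>0$ be strict partitions with $\mu\le\lambda$ and $r+s$ even. Let $\boldsymbol s\in ST^{\mathrm{diag}}(\lambda/\mu,\mathbb Z_{\ge1})$, i.e. $s_{ij}=a_{j-i}$ for positive integers $a_0,a_1,\ldots,a_{\lambda_1-1}$; also write $s_{ij}=a_{j-i}$ for every box $(i,j)\in SD(\lambda)$. Then, as formal power series in $t_1,t_2,\ldots$, \[ S_{\lambda/\mu}^Q(\boldsymbol s)=\mathrm{pf}\begin{pmatrix} M_\lambda & H_{\lambda,\mu}\\ 0&0\end{pmatrix}, \] where $M_\lambda=(a_{ij})$ is the $r\times r$ strictly upper triangular matrix with $a_{ij}=S^Q_{(\lambda_i,\lambda_j)}(\boldsymbol s_{(\lambda_i,\lambda_j)})$ for $i<j$, $\boldsymbol s_{(\lambda_i,\lambda_j)}$ being the shifted tableau of shape $(\lambda_i,\lambda_j)$ with first row $(s_{ii},\ldots,s_{i,t_i})$ and second row $(s_{jj},\ldots,s_{j,t_j})$ where here $t_i$ denotes the integer $i+\lambda_i-1$, and $H_{\lambda,\mu}=(b_{ij})$ is the $r\times s$ matrix with \[ b_{ij}=S^Q_{(\lambda_i-\mu_{s-j+1})}\bigl(s_{i,\,i+\mu_{s-j+1}},\ldots,s_{i,\,i+\lambda_i-1}\bigr), \] with the conventions that $b_{ij}=1$ if $\lambda_i=\mu_{s-j+1}$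 and $b_{ij}=0$ if $\lambda_i<\mu_{s-j+1}$.
   Context: A partition $\lambda=(\lambda_1,\ldots,\lambda_r)$ is strict if $\lambda_1>\cdots>\lambda_r\ge 0$. Its shifted diagram is $SD(\lambda)=\{(i,j)\in\mathbb Z^2 : 1\le i\le r,\ i\le j\le \lambda_i+i-1\}$ (row index $i$ increasing downwards, column index $j$ increasing to the right). Write $\mu\le\lambda$ if $SD(\mu)\subset SD(\lambda)$; then $SD(\lambda/\mu)=SD(\lambda)\setminus SD(\mu)$. $ST(\lambda/\mu,X)$ is the set of fillings of $SD(\lambda/\mu)$ with elements of $X$, and $ST^{\mathrm{diag}}(\lambda/\mu,X)$ is the subset of fillings constant on diagonals $j-i=\mathrm{const}$. Let $\mathbb N'=\{1',1,2',2,\ldots\}$ with total order $1'<1<2'<2<\cdots$, and put $|i|=|i'|=i$. $QSST(\lambda/\mu)$ is the set of $(m_{ij})\in ST(\lambda/\mu,\mathbb N')$ such that the entries are weakly increasing along each row and each column, for each $i=1,2,\ldots$ there is at most one $i'$ in each row, and for each $i$ there is at most one $i$ in each column. With formal variables $t_1,t_2,\ldots$, the Schur $Q$-type quasi-symmetric function is $S^Q_{\lambda/\mu}(\boldsymbol s)=\sum_{M\in QSST(\lambda/\mu)}\prod_{(i,j)\in SD(\lambda/\mu)}t_{|m_{ij}|}^{s_{ij}}\in\mathbb Z[[t_1,t_2,\ldots]]$; $S^Q_\lambda$ is the case $\mu=\emptyset$, and $S^Q_{(k)}(x_1,\ldots,x_k)$ is the value on the one-row tableau with entries $x_1,\ldots,x_k$.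 For a $2n\times 2n$ upper triangular matrix $A=(a_{ij})$, $\mathrm{pf}(A)=\sum_{\pi\in\mathfrak F_{2n}}\mathrm{sgn}(\pi)\prod_{i=1}^n a_{\pi(2i-1),\pi(2i)}$, where $\mathfrak F_{2n}$ is the set of $\pi\in\mathfrak S_{2n}$ with $\pi(1)<\pi(3)<\cdots<\pi(2n-1)$ and $\pi(2i-1)<\pi(2i)$ for all $i$. *)

(* Defs.v *)
From HB Require Import structures.
From mathcomp Require Import all_boot all_order all_fingroup all_algebra.
From mathcomp Require Import finmap.
From mathcomp Require Import boolp classical_sets functions cardinality fsbigop.
From mathcomp.multinomials Require Import monalg.

Set Implicit Arguments.
Unset Strict Implicit.
Unset Printing Implicit Defensive.

Import Order.TTheory GRing.Theory.
Local Open Scope classical_set_scope.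
Local Open Scope ring_scope.

(* Formal power series over R in countably many variables, with the Cauchy    *)
(* product. Variables are indexed from 0: index k stands for t_(k+1).         *)
Record fps (R : nzRingType) := Fps { coefps : {cmonom nat} -> R }.

Section FpsZmodule.
Variable R : nzRingType.
Implicit Types f g : fps R.

HB.instance Definition _ := gen_eqMixin (fps R).
HB.instance Definition _ := gen_choiceMixin (fps R).

Lemma fpsP f g : coefps f =1 coefps g -> f = g.
Proof. by case: f; case: g => g f /= /funext ->. Qed.

Definition fps0 : fps R := Fps (fun=> 0).
Definition fps_opp f := Fps (fun m => - coefps f m).
Definition fps_add f g := Fps (fun m => coefps f m + coefps g m).

Fact fps_addA : associative fps_add.
Proof. by move=> f g h; apply: fpsP => m /=; rewrite addrA. Qed.
Fact fps_addC : commutative fps_add.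
Proof. by move=> f g; apply: fpsP => m /=; rewrite addrC. Qed.
Fact fps_add0 : left_id fps0 fps_add.
Proof. by move=> f; apply: fpsP => m /=; rewrite add0r. Qed.
Fact fps_addN : left_inverse fps0 fps_opp fps_add.
Proof. by move=> f; apply: fpsP => m /=; rewrite addNr. Qed.

HB.instance Definition _ :=
  GRing.isZmodule.Build (fps R) fps_addA fps_addC fps_add0 fps_addN.

End FpsZmodule.

Definition splittings (m : {cmonom nat}) : set ({cmonom nat} * {cmonom nat}) :=
  [set p | mmul p.1 p.2 = m].

Lemma finite_divisors (m : {cmonom nat}) :
  finite_set [set d : {cmonom nat} | forall i, (d i <= m i)%N].
Proof.
pose N := (\max_(i <- finsupp m) m i)%N.
pose F (h : {ffun finsupp m -> 'I_N.+1}) : {cmonom nat} :=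
  mkcmonom [fsfun i : finsupp m => nat_of_ord (h i) | 0%N].
apply: (@sub_finite_set _ _ (F @` setT)); last first.
  by apply: finite_image; exact: finite_finset.
move=> d /= dm; exists [ffun i => inord (d (val i))] => //.
apply/eqP/cmP => i; rewrite cmE fsfun_ffun; case: insubP => [j ji ji_val|im] /=.
  rewrite ffunE ji_val inordK // ltnS (leq_trans (dm i)) //.
  by rewrite /N; apply: leq_bigmax_seq.
by move: (dm i); rewrite (fsfun_dflt im) leqn0 => /eqP ->.
Qed.

Lemma finite_splittings m : finite_set (splittings m).
Proof.
pose D := [set d : {cmonom nat} | forall i, (d i <= m i)%N].
apply: (@sub_finite_set _ _ (D `*` D)).
  move=> [a b]; rewrite /splittings /D /= => <-; split => i /=; rewrite mulcmE; first exact: leq_addr.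
  exact: leq_addl.
by apply: finite_setX; exact: finite_divisors.
Qed.

Section FpsRing.
Variable R : comNzRingType.
Implicit Types f g h : fps R.

Definition fps1 : fps R := Fps (fun m => (m == mone)%:R).

Definition fps_mul f g : fps R :=
  Fps (fun m => \sum_(p \in splittings m) coefps f p.1 * coefps g p.2).

Lemma coefps_mul (B : {fset {cmonom nat}}) f g m :
    (forall a b, mmul a b = m -> (a \in B) && (b \in B)) ->
  coefps (fps_mul f g) m =
    \sum_(a <- B) \sum_(b <- B)
      (if mmul a b == m then coefps f a * coefps g b else 0).
Proof.
move=> mB /=.
pose F p := coefps f p.1 * coefps g p.2.
transitivity (\sum_(p <- [seq (a, b) | a <- B, b <- B])
    (if mmul p.1 p.2 == m then F p else 0)); last by rewrite big_allpairs.
rewrite -[RHS]big_mkcond -[RHS]big_filter /=.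
apply: fsbig_fwiden.
- move=> [a b]; rewrite /splittings /= => abm.
  rewrite mem_filter /= abm eqxx /=.
  by have /andP[aB bB] := mB _ _ abm; apply: allpairs_f.
- apply: filter_uniq; apply: allpairs_uniq; [exact: fset_uniq..|].
  by move=> [? ?] [? ?] _ _.
- move=> [a b] [] /=; rewrite mem_filter /= => /andP[/eqP abm _].
  by case; rewrite /splittings.
Qed.

Lemma divisors_fset m : exists B : {fset {cmonom nat}},
  forall d, (d \in B) = `[< exists e, mmul d e = m >].
Proof.
exists (fset_set (fst @` splittings m)) => d.
rewrite in_fset_set; last by apply: finite_image; exact: finite_splittings.
apply/idP/asboolP => [|[e de]].
  by rewrite inE => -[[a b] /= abm <-]; exists b.
by rewrite inE; exists (d, e).
Qed.

Fact fps_mulC : commutative fps_mul.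
Proof.
move=> f g; apply: fpsP => m; have [B BP] := divisors_fset m.
have mB a b : mmul a b = m -> (a \in B) && (b \in B).
  move=> abm; rewrite !BP; apply/andP; split; apply/asboolP; first by exists b.
  by exists a; rewrite mulmC.
rewrite !(coefps_mul _ _ mB) exchange_big /=.
by apply: eq_bigr => a _; apply: eq_bigr => b _; rewrite mulmC mulrC.
Qed.

Fact fps_mul1 : left_id fps1 fps_mul.
Proof.
move=> f; apply: fpsP => m /=.
rewrite (fsbigD1 (mone, m)) /=; [|exact: finite_splittings|exact: mul1m].
rewrite eqxx mul1r fsbig1 ?addr0 // => -[a b] [] /=.
rewrite /splittings /= => abm abn; case: eqP => [a1|_]; last by rewrite mul0r.
by case: abn; rewrite -abm a1 mul1m.
Qed.

Fact fps_mulDl : left_distributive fps_mul (@fps_add R).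
Proof.
move=> f g h; apply: fpsP => m /=.
rewrite -fsbig_split; last exact: finite_splittings.
by apply: eq_fsbigr => p _; rewrite mulrDl.
Qed.

Fact fps_mulA : associative fps_mul.
Proof.
suff mulE f g h m (B : {fset {cmonom nat}}) :
    (forall d, (d \in B) = `[< exists e, mmul d e = m >]) ->
    coefps (fps_mul (fps_mul f g) h) m =
    \sum_(a <- B) \sum_(b <- B) \sum_(c <- B)
      (if mmul (mmul a b) c == m
       then coefps f a * coefps g b * coefps h c else 0).
  move=> f g h; apply: fpsP => m; have [B BP] := divisors_fset m.
  rewrite [fps_mul f (fps_mul _ _)]fps_mulC !(mulE _ _ _ _ _ BP).
  rewrite [LHS](eq_bigr _ (fun a _ => exchange_big _ _ _ _ _ _)) /=.
  rewrite [LHS]exchange_big /=.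
  apply: eq_bigr => a _; apply: eq_bigr => b _; apply: eq_bigr => c _.
  by rewrite [mmul (mmul b c) a]mulmC mulmA [_ * coefps f a]mulrC mulrA.
move=> BP.
have mB a b : mmul a b = m -> (a \in B) && (b \in B).
  move=> abm; rewrite !BP; apply/andP; split; apply/asboolP; first by exists b.
  by exists a; rewrite mulmC.
rewrite (coefps_mul _ _ mB).
transitivity (\sum_(p <- B) \sum_(c <- B) \sum_(a <- B) \sum_(b <- B)
    (if (mmul p c == m) && (mmul a b == p)
     then coefps f a * coefps g b * coefps h c else 0)).
  apply: eq_bigr => p _; apply: eq_bigr => c _.
  case: eqP => [pcm|_]; last by rewrite big1 // => a _; rewrite big1.
  rewrite (@coefps_mul B) => [|a b abp].
    rewrite mulr_suml; apply: eq_bigr => a _; rewrite mulr_suml.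
    by apply: eq_bigr => b _ /=; case: eqP => _; rewrite ?mul0r.
  rewrite !BP; apply/andP; split; apply/asboolP.
    by exists (mmul b c); rewrite mulmA abp.
  by exists (mmul a c); rewrite mulmA (mulmC b) abp.
rewrite exchange_big /=.
transitivity (\sum_(c <- B) \sum_(a <- B) \sum_(b <- B)
    (if mmul (mmul a b) c == m
     then coefps f a * coefps g b * coefps h c else 0)).
  apply: eq_bigr => c _; rewrite exchange_big /=; apply: eq_bigr => a _.
  rewrite exchange_big /=; apply: eq_bigr => b _.
  case: eqP => [abcm|abcm].
    have abB : mmul a b \in B by rewrite BP; apply/asboolP; exists c.
    rewrite (bigD1_seq (mmul a b)) //=; last exact: fset_uniq.
    rewrite abcm !eqxx /= big1 ?addr0 // => p.
    by rewrite eq_sym => /negPf ->; rewrite andbF.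
  rewrite big1 // => p _; case: ifP => // /andP[/eqP pcm /eqP abp].
  by case: abcm; rewrite abp.
rewrite exchange_big /=; apply: eq_bigr => a _.
by rewrite exchange_big.
Qed.

Fact fps1_neq0 : fps1 != 0 :> fps R.
Proof.
apply/eqP => /(congr1 (fun f => coefps f mone)) /=.
by rewrite eqxx; apply/eqP; exact: oner_neq0.
Qed.

HB.instance Definition _ := GRing.Zmodule_isComNzRing.Build (fps R)
  fps_mulA fps_mulC fps_mul1 fps_mulDl fps1_neq0.

End FpsRing.

Definition fps_mono (R : comNzRingType) (d : {cmonom nat}) : fps R :=
  Fps (fun m => (m == d)%:R).

Definition fps_var (R : comNzRingType) (k : nat) : fps R := fps_mono R (ucm k).

Section FpsMono.
Variable R : comNzRingType.

Lemma fps_mono1 : fps_mono R mone = 1.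
Proof. by []. Qed.

Lemma fps_monoM d e : fps_mono R d * fps_mono R e = fps_mono R (mmul d e).
Proof.
apply: fpsP => m /=; have [->|dem] := eqVneq.
  rewrite (fsbigD1 (d, e)) //=; last exact: finite_splittings.
  rewrite !eqxx mul1r fsbig1 ?addr0 // => -[x y] /= [_ xy].
  case: eqP => [xd|_]; last by rewrite mul0r.
  by case: eqP => [ye|_]; [case: xy; rewrite xd ye | rewrite mulr0].
rewrite fsbig1 // => -[x y]; rewrite /splittings /= => xym.
case: eqP => [xd|_]; last by rewrite mul0r.
case: eqP => [ye|_]; last by rewrite mulr0.
by rewrite -xd -ye xym eqxx in dem.
Qed.

Lemma fps_varX k n : exists2 d, fps_var R k ^+ n = fps_mono R d & d k = n.
Proof.
elim: n => [|n [d dE dk]]; first by exists mone; rewrite ?cm1.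
by exists (mmul (ucm k) d); rewrite ?exprS ?dE ?fps_monoM // cmM cmUU dk.
Qed.

End FpsMono.

Definition pf_fst n (i : 'I_n) : 'I_n.*2 :=
  @Ordinal n.*2 i.*2 (etrans (ltn_double i n) (ltn_ord i)).
Definition pf_snd n (i : 'I_n) : 'I_n.*2 :=
  @Ordinal n.*2 i.*2.+1 (etrans (ltn_Sdouble i n) (ltn_ord i)).

Definition pf_perms n : {set 'S_n.*2} :=
  [set p : 'S_n.*2 |
    [forall i : 'I_n, forall j : 'I_n,
      (i < j)%N ==> (p (pf_fst i) < p (pf_fst j))%N]
    && [forall i : 'I_n, (p (pf_fst i) < p (pf_snd i))%N]]%SET.

(* Only the entries strictly above the diagonal of A matter. *)
Definition pf (R : comNzRingType) n (A : 'M[R]_n.*2) : R :=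
  \sum_(p in pf_perms n)
    (-1) ^+ odd_perm p * \prod_(i < n) A (p (pf_fst i)) (p (pf_snd i)).

(* Boxes are pairs (row, column) counted from 0; the diagonal j - i does not  *)
(* depend on this choice.                                                     *)
Definition SD (lam : seq nat) : {fset nat * nat} :=
  [fset ((i, j) : nat * nat) | i in iota 0 (size lam),
                               j in iota i (nth 0%N lam i)]%fset.

Definition SDskew (lam mu : seq nat) : {fset nat * nat} :=
  (SD lam `\` SD mu)%fset.

Definition ST (lam mu : seq nat) (X : Type) := {ffun SDskew lam mu -> X}.

(* (k, false) is the letter (k+1)' and (k, true) is the letter k+1, in the    *)
(* lexicographic order with false < true.                                     *)
Definition letter := (nat *l bool)%type.
Definition absl (x : letter) : nat := x.1.

Definition QSST (lam mu : seq nat) : set (ST lam mu letter) :=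
  [set M : ST lam mu letter |
     [/\ forall b c, (val b).1 = (val c).1 ->
           ((val b).2 <= (val c).2)%N -> (M b <= M c)%O,
         forall b c, (val b).2 = (val c).2 ->
           ((val b).1 <= (val c).1)%N -> (M b <= M c)%O,
         forall k b c, (val b).1 = (val c).1 ->
           M b = (k, false) -> M c = (k, false) -> b = c
       & forall k b c, (val b).2 = (val c).2 ->
           M b = (k, true) -> M c = (k, true) -> b = c]].

Arguments QSST lam mu : clear implicits.

Definition SQ_term (lam mu : seq nat) (s : ST lam mu nat)
    (M : ST lam mu letter) : fps int :=
  \prod_(b : SDskew lam mu) fps_var int (absl (M b)) ^+ s b.

(* The infinite sum of series is taken coefficientwise; \sum_(M \in _) is the *)
(* sum of a finitely supported family, and SQ_term_finite below shows that    *)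
(* the support is finite as soon as s is positive.                            *)
Definition SQ (lam mu : seq nat) (s : ST lam mu nat) : fps int :=
  Fps (fun m => \sum_(M \in QSST lam mu) coefps (SQ_term s M) m).

Lemma SQ_term_finite (lam mu : seq nat) (s : ST lam mu nat) m :
    (forall b, 0 < s b)%N ->
  finite_set (QSST lam mu `&` [set M | coefps (SQ_term s M) m != 0]).
Proof.
move=> s_gt0.
pose F (h : {ffun SDskew lam mu -> finsupp m * bool}) : ST lam mu letter :=
  [ffun b => (val (h b).1, (h b).2)].
apply: (@sub_finite_set _ _ (F @` setT)); last first.
  by apply: finite_image; exact: finite_finset.
move=> M [_ /= mM].
have absM b : absl (M b) \in finsupp m.
  rewrite -cmE_neq0 -lt0n (leq_trans (s_gt0 b)) //.
  have [d dE dM] : exists2 d, SQ_term s M = fps_mono int d &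
      forall b, (s b <= d (absl (M b)))%N.
    suff [d dE dM] : exists2 d, \prod_(b <- index_enum (SDskew lam mu))
          fps_var int (absl (M b)) ^+ s b = fps_mono int d &
        {in index_enum (SDskew lam mu), forall b, (s b <= d (absl (M b)))%N}.
      by exists d => // c; apply: dM; rewrite mem_index_enum.
    elim: (index_enum _) => [|c l [d dE dM]].
      by exists mone; rewrite ?big_nil ?fps_mono1.
    have [e eE ec] := fps_varX int (absl (M c)) (s c).
    exists (mmul e d); first by rewrite big_cons dE eE fps_monoM.
    move=> c'; rewrite inE cmM => /predU1P[->|/dM]; first by rewrite ec leq_addr.
    by move=> /leq_trans -> //; rewrite leq_addl.
  by move: mM; rewrite dE /=; case: (m =P d) => [->|_].
exists [ffun b => ([` absM b]%fset, (M b).2)] => //.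
by apply/ffunP => b; rewrite !ffunE /= /absl; case: (M b).
Qed.

(* Tableau of shape lam given by its rows, each listed from the diagonal on.  *)
Definition tab (lam : seq nat) (rows : seq (seq nat)) : ST lam [::] nat :=
  [ffun b => nth 0%N (nth [::] rows (val b).1) ((val b).2 - (val b).1)].

Definition SQrow (x : seq nat) : fps int := SQ (tab [:: size x] [:: x]).

Section Entries.
Variables (r s : nat) (lam : r.-tuple nat) (mu : s.-tuple nat) (a : nat -> nat).

(* [:: s_(i,j); s_(i,j+1); ...; s_(i,j+l-1)], where s_(i,j) = a_(j-i) *)
Definition row_entries (i j l : nat) : seq nat :=
  [seq a (k - i)%N | k <- iota j l].

Definition Mmx : 'M[fps int]_r :=
  \matrix_(i, j)
    if (i < j)%N then
      SQ (tab [:: tnth lam i; tnth lam j]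
            [:: row_entries i i (tnth lam i); row_entries j j (tnth lam j)])
    else 0.

(* tnth mu (rev_ord j) is mu_(s-j+1) in 1-based indexing. *)
Definition Hmx : 'M[fps int]_(r, s) :=
  \matrix_(i, j)
    let l := tnth lam i in let m := tnth mu (rev_ord j) in
    if (l < m)%N then 0
    else if l == m then 1
    else SQrow (row_entries i (i + m) (l - m)).

End Entries.

(* Main.v *)
Require Import Defs.
From mathcomp Require Import all_boot all_order all_fingroup all_algebra.
From mathcomp Require Import finmap.
From mathcomp Require Import boolp classical_sets functions fsbigop.
From mathcomp.multinomials Require Import monalg.
From mathcomp Require Import zify ring.

(** Order the pairs (letter, content) by letter first, then by decreasing content
    for a marked letter and by increasing content for an unmarked one, and call
    [rank] the position of a pair in that order. Along a row contents increase and
    along a column they decrease, so the conditions defining [QSST] say exactly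
    that the ranks of the entries increase strictly along rows and columns
    ([rank_row], [rank_col]), while a rank determines the content of its box. A
    tableau is thus a growth process from mu to lambda: at time v one may add the
    box of content [cont v], with weight [w v], if it is a corner.

    In terms of the parts, adding a box of content c turns a part c into c + 1, so
    the generating function G_v(lambda) of all tableaux with entries at most v
    satisfies

      G_(v+1)(lambda) = G_v(lambda) + w_(v+1) G_v(lambda with c + 1 replaced by c)

    where the last term is present when c + 1 is a part and either c = 0 or c is
    not a part. This recursion, [growth], is all that is needed from the tableaux
    ([tabsum_growth]).

    The Pfaffian satisfies the same recursion ([growth_pfs]), for any sequences of
    contents and weights. Its entries are themselves values of G for two rows and
    for one row, hence at each step the index c + 1 receives w times the index c.
    The Pfaffian is linear in each index ([pfs_lin]), and if c is a part too then
    the extra term has two equal adjacent indices and vanishes ([pfs_adj_eq]). The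
    one exception is c = 0 with both 1 and 0 present: the entry at (1, 0) gains a
    further w, because two empty rows have generating function 1 and not 0. This
    adds w times the Pfaffian without these two indices ([pfs_bump]), which is what
    the recursion asks for, as removing the box of the part 1 leaves two zero
    parts. At time 0 the only nonzero entries are those pairing a part of lambda
    with an equal part of mu, so that the Pfaffian is 1 if lambda = mu and 0
    otherwise. The columns of H list mu backwards, so this pairing is nested, and a
    nested pairing has sign +1.

    Infinitely many letters are dealt with coefficientwise: as all exponents are
    positive, a monomial in the first N variables only receives contributions from
    the letters of absolute value at most N, so modulo the other variables every
    series involved is a finite sum of the above kind ([SQ_tabsum]). *)

Set Implicit Arguments.
Unset Strict Implicit.
Unset Printing Implicit Defensive.

Import Order.TTheory GRing.Theory.
Local Open Scope ring_scope.

(** * Pfaffians indexed by lists *)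

Section AlternatingSums.
Variables (T : Type) (R : comNzRingType).
Implicit Types (F G : T -> seq T -> R) (l : seq T).

(** Alternating sum over the elements of [l], each passed to [F] together with the
    list that remains when it is removed: the first-row expansion of a Pfaffian
    without mention of positions, see [altsumE]. *)
Fixpoint altsum F l : R :=
  if l is v :: l' then F v l' - altsum (fun z l'' => F z (v :: l'')) l'
  else 0.

Lemma eq_altsum F G l :
    (forall l1 z l2, l = l1 ++ z :: l2 -> F z (l1 ++ l2) = G z (l1 ++ l2)) ->
  altsum F l = altsum G l.
Proof.
elim: l F G => //= v l IH F G FG; congr (_ - _); first exact: (FG [::]).
by apply: IH => l1 z l2 lE; apply: (FG (v :: l1)); rewrite lE.
Qed.

Lemma altsumD F G l :
  altsum (fun z l' => F z l' + G z l') l = altsum F l + altsum G l.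
Proof.
elim: l F G => [|v l IH] F G /=; first by rewrite addr0.
by rewrite (IH (fun z l => F z (v :: l)) (fun z l => G z (v :: l))) opprD addrACA.
Qed.

Lemma altsumZ x F l : altsum (fun z l' => x * F z l') l = x * altsum F l.
Proof.
elim: l F => [|v l IH] F /=; first by rewrite mulr0.
by rewrite (IH (fun z l => F z (v :: l))) mulrBr.
Qed.

Lemma altsum0 F l :
  (forall l1 z l2, l = l1 ++ z :: l2 -> F z (l1 ++ l2) = 0) -> altsum F l = 0.
Proof.
move=> F0; rewrite (eq_altsum (G := fun z l' => 0 * F z l')) ?altsumZ ?mul0r //.
by move=> l1 z l2 /F0 ->; rewrite mul0r.
Qed.

Lemma altsum_cat F l1 l2 :
  altsum F (l1 ++ l2) = altsum (fun z l => F z (l ++ l2)) l1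
    + (-1) ^+ size l1 * altsum (fun z l => F z (l1 ++ l)) l2.
Proof.
elim: l1 F => [|v l1 IH] F /=; first by rewrite mul1r add0r.
by rewrite IH exprS mulN1r mulNr opprD addrA.
Qed.

(** Removing z then z', or z' then z, leaves the same list with opposite signs. *)
Lemma altsum_sym0 (H : T -> T -> seq T -> R) l :
  (forall z z' l', H z z' l' = H z' z l') ->
  altsum (fun z l' => altsum (H z) l') l = 0.
Proof.
elim: l H => //= v l IH H Hsym.
rewrite [X in _ - X](eq_altsum (G := fun z l' =>
  H v z l' + -1 * altsum (fun z' l'' => H z z' (v :: l'')) l')); last first.
  by move=> l1 z l2 _ /=; rewrite [H z v _]Hsym mulN1r.
rewrite altsumD altsumZ IH => [|z z' l']; last exact: Hsym.
by rewrite mulr0 addr0 subrr.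
Qed.

Lemma altsumE F x0 l :
  altsum F l = \sum_(j < size l)
    (-1) ^+ j * F (nth x0 l j) (take j l ++ drop j.+1 l).
Proof.
elim: l F => [|v l IH] F /=; first by rewrite big_ord0.
rewrite big_ord_recl mul1r /= drop0 IH -sumrN; congr (_ + _).
by apply: eq_bigr => j _; rewrite /= exprS mulN1r mulNr.
Qed.

End AlternatingSums.

Section ListPfaffian.
Variables (T : Type) (R : comNzRingType).
Implicit Types (A : T -> T -> R) (l : seq T).

(** Pfaffian of [A] over the indices listed in [l], by expansion along the first
    index. Half the length is the recursion parameter [n]; the value is 0 for lists
    of any other length, so that identities need no hypothesis on the length. *)
Fixpoint pfs A n l : R :=
  match n, l with
  | 0, _ => (nilp l)%:R
  | _, [::] => 0
  | n'.+1, u :: l' => altsum (fun z l'' => A u z * pfs A n' l'') l'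
  end.

Lemma pfs0 A l : pfs A 0 l = (nilp l)%:R. Proof. by []. Qed.

Lemma pfs_cons A n u l :
  pfs A n.+1 (u :: l) = altsum (fun z l' => A u z * pfs A n l') l.
Proof. by []. Qed.

Arguments pfs : simpl never.

(** Expanding along both equal indices gives a double alternating sum of a
    symmetric function; equal indices further down the list occur with opposite
    signs when one of them is removed. *)
Lemma pfs_adj_eq A y n l1 l2 :
  A y y = 0 -> pfs A n (l1 ++ y :: y :: l2) = 0.
Proof.
move=> Ayy; elim: n l1 l2 => [|n IH] [|u l1] l2 //; rewrite pfs_cons /=.
  rewrite Ayy mul0r add0r; apply/eqP; rewrite oppr_eq0; apply/eqP.
  case: n {IH} => [|n]; first by apply: altsum0 => *; rewrite mulr0.
  rewrite (eq_altsum (G := fun z l' => altsum (fun z' l'' =>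
      A y z * (A y z' * pfs A n l'')) l')); last by move=> *; rewrite -altsumZ.
  by apply: altsum_sym0 => z z' l'; rewrite mulrCA.
rewrite altsum_cat altsum0 => [|k1 z k2 _]; last by rewrite IH mulr0.
rewrite /= [altsum _ l2]altsum0 => [|k1 z k2 _]; last by rewrite IH mulr0.
by rewrite subr0 subrr mulr0 addr0.
Qed.

End ListPfaffian.

Arguments pfs : simpl never.

Section ListPfaffianEq.
Variables (T : eqType) (R : comNzRingType).
Implicit Types (A B : T -> T -> R) (l : seq T).

Lemma eq_pfs A B n l :
  {in l &, forall u v, A u v = B u v} -> pfs A n l = pfs B n l.
Proof.
elim: n l => [|n IH] [|u l] // AB; rewrite !pfs_cons; apply: eq_altsum => l1 z l2 lE.
rewrite AB ?inE ?eqxx ?lE ?mem_cat ?mem_head ?orbT //; congr (_ * _).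
have sub : {subset l1 ++ l2 <= u :: l}.
  by move=> x; rewrite inE lE !mem_cat inE => /orP[]->; rewrite ?orbT.
by apply: IH => x y xl yl; apply: AB; apply: sub.
Qed.

(** In every term of the expansion the index [y] occurs once, either as a row or
    as a column. *)
Lemma pfs_lin A B x y y' n l1 l2 :
    {in predC1 y, forall v, B y v = A y v + x * A y' v} ->
    {in predC1 y, forall u, B u y = A u y + x * A u y'} ->
    {in predC1 y &, forall u v, B u v = A u v} ->
    y \notin l1 -> y \notin l2 ->
  pfs B n (l1 ++ y :: l2) =
    pfs A n (l1 ++ y :: l2) + x * pfs A n (l1 ++ y' :: l2).
Proof.
move=> By1 By2 Buv.
have neq z k1 k2 l : y \notin l -> l = k1 ++ z :: k2 ->
    [/\ z \in predC1 y, y \notin k1 & y \notin k2].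
  move=> yl lE; move: yl; rewrite lE mem_cat inE !negb_or => /and3P[-> yz ->].
  by rewrite inE eq_sym.
have BA k m : y \notin k -> pfs B m k = pfs A m k.
  move=> yk; apply: eq_pfs => u v uk vk; apply: Buv; rewrite inE.
    by apply: contraNneq yk => <-.
  by apply: contraNneq yk => <-.
elim: n l1 l2 => [|n IH] [|u l1] l2;
  rewrite ?cat0s ?cat_cons ?pfs0 ?pfs_cons ?mulr0 ?addr0 //.
  move=> _ yl2; rewrite -altsumZ -altsumD; apply: eq_altsum => k1 z k2 lE.
  have [zy yk1 yk2] := neq _ _ _ _ yl2 lE.
  by rewrite By1 // BA ?mem_cat ?negb_or ?yk1 // mulrDl mulrA.
rewrite inE negb_or => /andP[yu yl1] yl2.
have {}yu : u \in predC1 y by rewrite inE eq_sym.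
rewrite !altsum_cat /= mulrDr.
rewrite (eq_altsum (G := fun z l => (A u z * pfs A n (l ++ y :: l2))
   + x * (A u z * pfs A n (l ++ y' :: l2)))); last first.
  move=> k1 z k2 lE; have [zy yk1 yk2] := neq _ _ _ _ yl1 lE.
  by rewrite Buv // IH //= ?mem_cat ?negb_or ?yk1 //; ring.
rewrite [altsum (fun z l => B u z * _) l2](eq_altsum (G := fun z l =>
    (A u z * pfs A n (l1 ++ y :: l))
   + x * (A u z * pfs A n (l1 ++ y' :: l)))); last first.
  move=> k1 z k2 lE; have [zy yk1 yk2] := neq _ _ _ _ yl2 lE.
  by rewrite Buv // IH //= ?mem_cat ?negb_or ?yk1 //; ring.
rewrite !altsumD !altsumZ By2 // BA ?mem_cat ?negb_or ?yl1 //; ring.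
Qed.

(** The terms affected are those that pair the adjacent [y] and [z]; removing both
    leaves all signs unchanged. *)
Lemma pfs_bump A B x y z n l1 l2 :
    B y z = A y z + x ->
    (forall u v, (u, v) != (y, z) -> B u v = A u v) ->
    uniq (l1 ++ y :: z :: l2) ->
  pfs B n.+1 (l1 ++ y :: z :: l2) =
    pfs A n.+1 (l1 ++ y :: z :: l2) + x * pfs A n (l1 ++ l2).
Proof.
move=> Byz Buv.
have BA k m : ~~ ((y \in k) && (z \in k)) -> pfs B m k = pfs A m k.
  move=> yzk; apply: eq_pfs => u v uk vk; apply: Buv.
  by apply: contraNneq yzk => -[<- <-]; apply/andP.
have BAu u v : u != y -> B u v = A u v.
  by move=> uy; apply: Buv; apply: contraNneq uy => -[->].
have BAv u v : v != z -> B u v = A u v.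
  by move=> uy; apply: Buv; apply: contraNneq uy => -[_ ->].
elim: n l1 l2 => [|n IH] [|u l1] l2; rewrite ?cat0s ?cat_cons !pfs_cons //=.
- rewrite inE negb_or => /and3P[/andP[yz yl2] zl2 _].
  rewrite Byz mulrDl addrAC; congr (_ - _ + _).
  apply: eq_altsum => k1 v k2 lE; rewrite BAv //.
  by move: zl2; rewrite lE mem_cat inE !negb_or eq_sym => /and3P[_ ->].
- move=> /andP[uyz _]; rewrite pfs0 mulr0 addr0; apply: eq_altsum => k1 v k2 _.
  by rewrite BAu //; move: uyz; rewrite mem_cat inE !negb_or => /and3P[].
- rewrite inE negb_or => /and3P[/andP[yz yl2] zl2 _].
  rewrite Byz BA ?(negPf yl2) // mulrDl addrAC; congr (_ - _ + _).
  apply: eq_altsum => k1 v k2 lE; rewrite BAv.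
    rewrite (BA _ n.+1) //.
    by move: yl2 zl2; rewrite lE !inE !mem_cat !inE !negb_or (eq_sym z) (negPf yz)
      => /and3P[/negPf-> _ /negPf->].
  by move: zl2; rewrite lE mem_cat inE !negb_or eq_sym => /and3P[_ ->].
move=> /andP[uyz unl].
have uy : u != y by move: uyz; rewrite mem_cat inE !negb_or => /and3P[].
have [yl zl] : y \notin l1 ++ l2 /\ z \notin l1 ++ l2.
  move: unl; rewrite (uniq_catCA l1 [:: y; z] l2) /= inE negb_or.
  by case/and3P => /andP[_ yl] zl _.
have yz : y != z.
  by move: unl; rewrite (uniq_catCA l1 [:: y; z] l2) /= inE negb_or => /andP[/andP[]].
rewrite !altsum_cat /= mulrDr.
rewrite (eq_altsum (G := fun v l => (A u v * pfs A n.+1 (l ++ y :: z :: l2))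
   + x * (A u v * pfs A n (l ++ l2)))); last first.
  move=> k1 v k2 lE; rewrite BAu // IH; first by ring.
  move: unl; rewrite lE; apply: subseq_uniq.
  by rewrite -!catA cat_subseq ?subseq_refl // cat_cons; apply: subseq_cons.
rewrite [altsum (fun v l => B u v * _) l2](eq_altsum (G := fun v l =>
    (A u v * pfs A n.+1 (l1 ++ y :: z :: l))
   + x * (A u v * pfs A n (l1 ++ l)))); last first.
  move=> k1 v k2 lE; rewrite BAu // IH; first by ring.
  move: unl; rewrite lE; apply: subseq_uniq.
  rewrite cat_subseq ?subseq_refl //= !eqxx cat_subseq ?subseq_refl //.
  exact: subseq_cons.
move: yl zl; rewrite !mem_cat !negb_or => /andP[/negPf yl1 /negPf yl2].
move=> /andP[/negPf zl1 /negPf zl2].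
have BA1 : pfs B n.+1 (l1 ++ y :: l2) = pfs A n.+1 (l1 ++ y :: l2).
  by apply: BA; rewrite !mem_cat !inE zl1 zl2 (eq_sym z) (negPf yz) andbF.
have BA2 : pfs B n.+1 (l1 ++ z :: l2) = pfs A n.+1 (l1 ++ z :: l2).
  by apply: BA; rewrite !mem_cat !inE yl1 yl2 (negPf yz).
rewrite !altsumD !altsumZ !BAu // BA1 BA2; ring.
Qed.

End ListPfaffianEq.

(** Every perfect matching has to use an entry at [v]. *)
Lemma pfs_isolated (T : eqType) (R : comNzRingType) (A : T -> T -> R) v n l :
    v \in l -> {in l, forall u, A u v = 0 /\ A v u = 0} ->
  pfs A n l = 0.
Proof.
elim: n l => [|n IH] [|u l] // vl Av; rewrite pfs_cons altsum0 // => l1 z l2 lE.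
have [uv|uv] := eqVneq u v.
  by rewrite uv (Av z _).2 ?mul0r // inE lE mem_cat mem_head !orbT.
have [->|zv] := eqVneq z v; first by rewrite (Av u _).1 ?mul0r ?mem_head.
rewrite IH ?mulr0 // => [|x xl]; last first.
  apply: Av; rewrite inE lE mem_cat inE orbCA orbA orbA orbC.
  by move: xl; rewrite mem_cat => /orP[]->; rewrite ?orbT.
move: vl; rewrite inE lE !mem_cat inE eq_sym (negPf uv) /=.
by rewrite [v == z]eq_sym (negPf zv).
Qed.

(** * Row expansion of the Pfaffian *)

Section PfaffianExpansion.

Lemma lift_permP n (i j : 'I_n.+1) (s : 'S_n.+1) :
  s i = j -> exists s', s = lift_perm i j s'.
Proof.
move=> sij.
have ul k : {k' | s (lift i k) = lift j k'}.
  have: j != s (lift i k) by rewrite -sij (inj_eq perm_inj) neq_lift.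
  by move=> /unlift_some[k' kE _]; exists k'.
have inj : injective (fun k => sval (ul k)).
  move=> k1 k2 /(congr1 (lift j)); rewrite -!(svalP (ul _)) => /perm_inj.
  exact: lift_inj.
exists (perm inj); apply/permP => k; case: (unliftP i k) => [k'|] ->.
  by rewrite lift_perm_lift permE -(svalP (ul k')).
by rewrite lift_perm_id.
Qed.

Lemma lift_perm_inj n (i j : 'I_n.+1) : injective (@lift_perm n i j).
Proof.
move=> s s' ss'; apply/permP => k; apply: (@lift_inj _ j).
by rewrite -!(lift_perm_lift i) ss'.
Qed.

Lemma pf_permsP n (p : 'S_n.*2) :
  reflect ((forall i j : 'I_n, i < j -> p (pf_fst i) < p (pf_fst j))%N /\
           (forall i : 'I_n, p (pf_fst i) < p (pf_snd i))%N)
          (p \in pf_perms n).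
Proof.
rewrite inE; apply: (iffP andP) => -[H1 H2]; split.
- by move=> i j ij; have /forallP/(_ j)/implyP := forallP H1 i; apply.
- by move=> i; have := forallP H2 i.
- by apply/forallP => i; apply/forallP => j; apply/implyP; apply: H1.
- by apply/forallP => i; apply: H2.
Qed.

(** Pairs the first index with the [j]-th of the others, and the remaining ones
    according to [q]. *)
Definition pf_ext n (jq : 'I_n.*2.+1 * 'S_n.*2) : 'S_n.+1.*2 :=
  lift_perm ord0 ord0 (lift_perm ord0 jq.1 jq.2).

Section Extension.
Variables (n : nat) (j : 'I_n.*2.+1) (q : 'S_n.*2).

Lemma pf_ext_fst0 : pf_ext (j, q) (pf_fst ord0) = ord0 :> 'I_(n.*2.+2).
Proof.
rewrite (_ : pf_fst ord0 = ord0 :> 'I_(n.*2.+2)) ?lift_perm_id //.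
exact: val_inj.
Qed.

Lemma pf_ext_snd0 : pf_ext (j, q) (pf_snd ord0) = lift ord0 j :> 'I_(n.*2.+2).
Proof.
rewrite (_ : pf_snd ord0 = lift ord0 ord0 :> 'I_(n.*2.+2)); last exact: val_inj.
by rewrite lift_perm_lift lift_perm_id.
Qed.

Lemma pf_ext_fst i :
  pf_ext (j, q) (pf_fst (lift ord0 i)) = lift ord0 (lift j (q (pf_fst i)))
    :> 'I_(n.*2.+2).
Proof.
rewrite (_ : pf_fst (lift ord0 i) = lift ord0 (lift ord0 (pf_fst i))
  :> 'I_(n.*2.+2)); last exact: val_inj.
by rewrite !lift_perm_lift.
Qed.

Lemma pf_ext_snd i :
  pf_ext (j, q) (pf_snd (lift ord0 i)) = lift ord0 (lift j (q (pf_snd i)))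
    :> 'I_(n.*2.+2).
Proof.
rewrite (_ : pf_snd (lift ord0 i) = lift ord0 (lift ord0 (pf_snd i))
  :> 'I_(n.*2.+2)); last exact: val_inj.
by rewrite !lift_perm_lift.
Qed.

Lemma ltn_lift2 m (h : 'I_m.+1) (x y : 'I_m) : (lift h x < lift h y)%N = (x < y)%N.
Proof. by rewrite /= ltnNge leq_bump2 -ltnNge. Qed.

Lemma pf_ext_in : (pf_ext (j, q) \in pf_perms n.+1) = (q \in pf_perms n).
Proof.
apply/pf_permsP/pf_permsP => -[H1 H2]; split.
- move=> i k ik; have := H1 (lift ord0 i) (lift ord0 k).
  by rewrite !pf_ext_fst !ltn_lift2; apply.
- by move=> i; have := H2 (lift ord0 i); rewrite pf_ext_fst pf_ext_snd !ltn_lift2.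
- move=> i k; case: (unliftP ord0 i) => [i'|] ->; case: (unliftP ord0 k) => [k'|] -> //.
    by rewrite !pf_ext_fst !ltn_lift2; apply: H1.
  by rewrite pf_ext_fst0 pf_ext_fst.
- move=> i; case: (unliftP ord0 i) => [i'|] ->.
    by rewrite pf_ext_fst pf_ext_snd !ltn_lift2.
  by rewrite pf_ext_fst0 pf_ext_snd0.
Qed.

End Extension.

Lemma pf_ext_inj n : injective (@pf_ext n).
Proof.
move=> [j q] [j' q'] E; have jj' : j = j'.
  by apply: (@lift_inj _ ord0); rewrite -(pf_ext_snd0 j q) E pf_ext_snd0.
by move: E; rewrite jj' => /lift_perm_inj/lift_perm_inj /= ->.
Qed.

(** A normalized matching sends the first position to the least index: the first
    elements of the pairs increase, and each is the smaller one of its pair. *)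
Lemma pf_permsS n :
  pf_perms n.+1 = [set pf_ext jq | jq in [set jq | jq.2 \in pf_perms n]].
Proof.
apply/setP => p; apply/idP/imsetP => [pP|[[j q]]]; last first.
  by rewrite inE /= => qP ->; rewrite pf_ext_in.
have [H1 H2] := pf_permsP _ pP.
have p0 : (p : 'S_(n.*2.+2)) ord0 = ord0.
  pose k := (p^-1)%g (ord0 : 'I_n.*2.+2).
  have pk : p k = (ord0 : 'I_n.*2.+2) by rewrite /k permKV.
  have k2 : (k./2 < n.+1)%N by rewrite ltn_half_double; exact: ltn_ord.
  pose i := Ordinal k2.
  have pi : (p (pf_fst i) <= p k)%N.
    have [ko|ke] := boolP (odd k).
      by rewrite (_ : k = pf_snd i) ?(ltnW (H2 i)) //; apply: val_inj => /=; lia.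
    by rewrite (_ : k = pf_fst i) //; apply: val_inj => /=; lia.
  have p0i : (p (pf_fst ord0) <= p (pf_fst i))%N.
    have [i0|i0] := posnP i; last exact/ltnW/H1.
    by rewrite (_ : i = ord0) //; apply: val_inj.
  move: (leq_trans p0i pi); rewrite pk leqn0 => /eqP pE; apply: val_inj.
  by rewrite -[RHS]pE; congr (val (p _)); apply: val_inj.
have [s sE] := lift_permP p0.
have [q qE] := lift_permP (erefl (s ord0)).
have pE : p = pf_ext (s ord0, q) by rewrite /pf_ext /= -qE.
by exists (s ord0, q) => //; rewrite inE /= -(pf_ext_in (s ord0)) -pE.
Qed.

Variable R : comNzRingType.

(** Putting j + 1 in second position costs j transpositions, the sign of
    [lift_perm ord0 j]. *)
Lemma pf_expand n (A : 'M[R]_n.*2.+2) :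
  pf (n := n.+1) A = \sum_(j < n.*2.+1) (-1) ^+ j * (A ord0 (lift ord0 j) *
    pf (n := n)
      (\matrix_(i, k) A (lift ord0 (lift j i)) (lift ord0 (lift j k)))).
Proof.
rewrite {1}/pf pf_permsS big_imset /=; last by move=> x y _ _; apply: pf_ext_inj.
under [RHS]eq_bigr => j _ do rewrite mulrA /pf mulr_sumr.
rewrite pair_big_dep /=; apply: eq_big => [[j q]|[j q] _]; first by rewrite inE.
rewrite big_ord_recl pf_ext_fst0 pf_ext_snd0.
rewrite !odd_lift_perm /= signr_addb signr_odd.
under eq_bigr => i _ do rewrite pf_ext_fst pf_ext_snd.
under [in RHS]eq_bigr => i _ do rewrite mxE.
by rewrite -!mulrA; congr (_ * _); rewrite mulrCA.
Qed.

(** Both sides have the same expansion along the first index. *)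
Lemma pf_pfs (T : Type) (x0 : T) (f : T -> T -> R) n (l : seq T)
    (A : 'M[R]_n.*2) :
    size l = n.*2 -> (forall i j, A i j = f (nth x0 l i) (nth x0 l j)) ->
  pf A = pfs f n l.
Proof.
elim: n l A => [|n IH] l A sl AE.
  rewrite pfs0 (size0nil sl) /pf (big_pred1 1%g) => [|p].
    by rewrite odd_perm1 big_ord0 mulr1.
  have -> : p = 1%g by apply/permP => -[].
  by rewrite /= eqxx; apply/pf_permsP; split => -[].
case: l sl AE => // u l [sl] AE.
rewrite pfs_cons (altsumE _ x0) pf_expand sl; apply: eq_bigr => j _.
congr (_ * _); rewrite AE /=; congr (_ * _).
have jl : (j <= size l)%N by rewrite sl ltnW.
apply: IH.
  by rewrite size_cat size_drop size_takel // sl; have := ltn_ord j; lia.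
have nthE (i : 'I_n.*2) : nth x0 l (bump j i) =
    nth x0 (take j l ++ drop j.+1 l) i.
  rewrite nth_cat size_takel // /bump; have [ij|ij] := ltnP i j.
    by rewrite nth_take // leqNgt ij.
  by rewrite nth_drop; congr nth; lia.
by move=> i k; rewrite mxE AE /= -!nthE.
Qed.

End PfaffianExpansion.

(** * Growth of strict partitions, and its Pfaffian formula *)

Section Growth.
Variables (R : comNzRingType) (cont : nat -> nat) (w : nat -> R).
Implicit Types (lam mu : seq nat).

(** The shifted diagram of [lam] has a corner of content [c]: the part c + 1 can be
    shortened and the parts remain distinct, up to zeros. *)
Definition removable c lam := (c.+1 \in lam) && ((c == 0)%N || (c \notin lam)).

Definition lower c lam := [seq if p == c.+1 then c else p | p <- lam].

(** Weighted count of the chains of strict partitions from [mu] to [lam] that, at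
    each time v = 1, ..., t, either stay or add the box of content [cont v], the
    latter with weight [w v]. The last step is read off first. *)
Fixpoint growth mu t lam : R :=
  if t is t'.+1 then
    growth mu t' lam +
      (if removable (cont t) lam then w t * growth mu t' (lower (cont t) lam)
       else 0)
  else ([seq p <- lam | 0 < p]%N == mu)%:R.

Lemma growthS mu t lam : growth mu t.+1 lam = growth mu t lam +
  (if removable (cont t.+1) lam
   then w t.+1 * growth mu t (lower (cont t.+1) lam) else 0).
Proof. by []. Qed.

Arguments growth : simpl never.

Lemma growth_rcons0 mu t lam : growth mu t (rcons lam 0%N) = growth mu t lam.
Proof.
elim: t lam => [|t IH] lam.
  by rewrite /growth filter_rcons.
have lowerE c : lower c (rcons lam 0%N) = rcons (lower c lam) 0%N.
  by rewrite /lower map_rcons.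
have removableE c : removable c (rcons lam 0%N) = removable c lam.
  by rewrite /removable !mem_rcons !inE /=; case: c.
by rewrite !growthS lowerE removableE !IH.
Qed.

Lemma growth_nil mu t : growth mu t [::] = ([::] == mu)%:R.
Proof. by elim: t => // t IH; rewrite growthS IH addr0. Qed.

(** The entries of the two nonzero blocks as functions of the parts: [inl] marks
    the parts of lambda and [inr] those of mu. The test [q < p] makes the entry at
    two equal parts 0, so that a repeated part behaves as a repeated index. *)
Definition growth_entry t (u v : nat + nat) : R :=
  match u, v with
  | inl p, inl q => if (q < p)%N then growth [::] t [:: p; q] else 0
  | inl p, inr m => growth [:: m] t [:: p]
  | _, _ => 0
  end.

(** The order of rows and columns in the block matrix, where the columns of H run
    through mu from its last part to its first. *)
Definition indices lam mu : seq (nat + nat) := map inl lam ++ map inr (rev mu).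

(** The first part of [lam] can only be paired with the last index, which is its
    copy; the list between them has even length, whence the sign +1. *)
Lemma growth_pfs0_diag lam :
    sorted gtn lam -> 0%N \notin lam ->
  pfs (growth_entry 0) (size lam) (indices lam lam) = 1.
Proof.
elim: lam => [|p lam IH] //=; rewrite inE negb_or => psrt /andP[p0 lam0].
have {}p0 : (0 < p)%N by rewrite lt0n eq_sym.
rewrite /indices /= pfs_cons altsum_cat altsum0 ?add0r; last first.
  move=> l1 z l2 lE; have /mapP[q _ ->] : z \in map inl lam.
    by rewrite lE mem_cat mem_head orbT.
  rewrite /= /growth /= p0 /=.
  by case: ifP; rewrite mul0r.
rewrite rev_cons map_rcons -cats1 altsum_cat altsum0 ?add0r /=; last first.
  move=> l1 z l2 lE; have /mapP[m] : z \in map inr (rev lam).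
    by rewrite lE mem_cat mem_head orbT.
  rewrite mem_rev => ml ->.
  have := order_path_min (rev_trans ltn_trans) psrt.
  move=> /allP/(_ _ ml) /= mp.
  rewrite /= /growth /= p0 eqseq_cons.
  by rewrite (gtn_eqF mp) mul0r.
rewrite cats0 -/(indices lam lam) IH //; last exact: path_sorted psrt.
rewrite !size_map size_rev /= /growth /= p0 eqxx subr0 !mulr1.
by rewrite -exprMn mulrNN mulr1 expr1n.
Qed.

(** A part that is not common to [lam] and [mu], or is zero, is an isolated
    index. *)
Lemma growth_pfs0 n lam mu :
    sorted gtn lam -> sorted gtn mu -> 0%N \notin mu ->
    (size lam + size mu = n.*2)%N ->
  growth mu 0 lam = pfs (growth_entry 0) n (indices lam mu).
Proof.
move=> slam smu mu0 sz.
have [lm|lm] := eqVneq lam mu.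
  subst mu; have -> : n = size lam by lia.
  rewrite growth_pfs0_diag //.
  rewrite /growth (_ : filter _ _ = lam) ?eqxx //; apply/all_filterP/allP => p pl.
  by rewrite lt0n; apply: contraNneq mu0 => <-.
have gtr : transitive gtn by apply: rev_trans ltn_trans.
have neq : [seq p <- lam | 0 < p]%N != mu.
  apply: contraNneq lm => fE; have [l0|l0] := boolP (0%N \in lam); last first.
    rewrite -fE eq_sym; apply/eqP/all_filterP/allP => p pl.
    by rewrite lt0n; apply: contraNneq l0 => <-.
  suff : size lam = (size mu).+1 by lia.
  rewrite -fE size_filter -(count_predC (fun p => 0 < p)%N lam).
  rewrite (@eq_count _ (predC _) (pred1 0%N)) => [|p /=]; last first.
    by rewrite /= lt0n negbK.
  rewrite count_uniq_mem ?l0 ?addn1 // (sorted_uniq gtr _ slam) // => p.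
  by rewrite /= ltnn.
rewrite [LHS]/growth (negPf neq).
have [|/allPn[p pl pm]] := boolP (all (fun p => p \in mu) lam); last first.
  rewrite (@pfs_isolated _ _ _ (inl p)) //.
    by rewrite mem_cat map_f.
  move=> [q|m]; rewrite mem_cat => ql; split=> //=.
  - case: ifP => // pq; rewrite /growth /=.
    by rewrite (leq_ltn_trans (leq0n _) pq).
  - case: ifP => // qp; rewrite /growth /=.
    by rewrite (leq_ltn_trans (leq0n _) qp).
  rewrite /growth /=; case: eqP => //; case: ifP => // _ [pm'].
  case/orP: ql => /mapP[x] // + [mx]; rewrite mem_rev -mx -pm'.
  by rewrite (negPf pm).
move=> /allP lm'.
have [|/allPn[m mm ml]] := boolP (all (fun m => m \in lam) mu); last first.
  rewrite (@pfs_isolated _ _ _ (inr m)) //.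
    by rewrite mem_cat map_f ?orbT // mem_rev.
  move=> [q|m']; rewrite mem_cat => ql; split=> //=.
  rewrite /growth /=; case: eqP => //; case: ifP => // _ [pm'].
  case/orP: ql => /mapP[x] // + [mx]; rewrite -mx pm'.
  by rewrite (negPf ml).
move=> /allP ml'; case/negP: lm; apply/eqP.
apply: (irr_sorted_eq gtr) => // [p|p]; first by rewrite /= ltnn.
by apply/idP/idP => [/lm'|/ml'].
Qed.

Lemma removable_notin c lam : c.+1 \notin lam -> removable c lam = false.
Proof. by rewrite /removable => /negPf->. Qed.

Lemma lower_split c l1 l2 : c.+1 \notin l1 -> c.+1 \notin l2 ->
  lower c (l1 ++ c.+1 :: l2) = l1 ++ c :: l2.
Proof.
move=> cl1 cl2; rewrite /lower map_cat /= eqxx.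
have nE l : c.+1 \notin l -> [seq if p == c.+1 then c else p | p <- l] = l.
  by move=> cl; apply: map_id_in => p pl; case: eqP pl cl => // -> ->.
by rewrite !nE.
Qed.

Lemma growth_notin c mu t lam : c = cont t.+1 -> c.+1 \notin lam ->
  growth mu t.+1 lam = growth mu t lam.
Proof. by move=> -> clam; rewrite growthS removable_notin // addr0. Qed.

Lemma growth_lower c mu t l1 l2 : c = cont t.+1 ->
    c.+1 \notin l1 -> c.+1 \notin l2 -> (c == 0)%N || (c \notin l1 ++ l2) ->
  growth mu t.+1 (l1 ++ c.+1 :: l2) =
    growth mu t (l1 ++ c.+1 :: l2) + w t.+1 * growth mu t (l1 ++ c :: l2).
Proof.
move=> cE cl1 cl2 c0; rewrite growthS -cE /removable mem_cat mem_head orbT /=.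
rewrite lower_split // ifT //; move: c0; rewrite !mem_cat inE.
by rewrite (_ : c == c.+1 = false) //; apply: ltn_eqF.
Qed.

(** A part c > 0 blocks the growth of a part c into c + 1. *)
Lemma growth_stuck c mu t lam : c = cont t.+1 -> (0 < c)%N -> c \in lam ->
  growth mu t.+1 lam = growth mu t lam.
Proof.
move=> -> c0 clam; rewrite growthS /removable clam orbF.
by rewrite (gtn_eqF c0) andbF addr0.
Qed.

(** The source of the correction at content 0: the empty shape has one tableau. *)
Lemma growth_00 t : growth [::] t [:: 0; 0]%N = 1.
Proof.
by rewrite (growth_rcons0 _ _ [:: 0%N]) (growth_rcons0 _ _ [::]) growth_nil.
Qed.

Section Step.
Variables (t c : nat).
Hypothesis cE : c = cont t.+1.
Let x := w t.+1.
Let A := growth_entry t.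
Let y : nat + nat := inl c.+1.
Let y' : nat + nat := inl c.

(** The entries after one step, except that the entry at (c + 1, c) keeps its
    previous value; this differs from the true entry only if c = 0. *)
Let B (u v : nat + nat) : R :=
  if (u, v) == (y, y') then A u v else growth_entry t.+1 u v.

Let By1 : {in predC1 y, forall v, B y v = A y v + x * A y' v}.
Proof.
move=> v; rewrite inE /B xpair_eqE eqxx /=; have [->|] := eqVneq v y'.
  by rewrite /= ltnn mulr0 addr0.
case: v => [q|m] vy' vy; last first.
  by rewrite /= (@growth_lower c _ _ [::] [::]) //= orbT.
have {vy'} qc : q != c by apply: contraNneq vy' => ->.
have {vy} qc1 : q != c.+1 by apply: contraNneq vy => ->.
rewrite /= ltnS leq_eqVlt (negPf qc) /=; case: ltnP => qc'.
  by rewrite (@growth_lower c _ _ [::] [:: q]) //= inE [_ == q]eq_sym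
     ?qc1 ?qc ?orbT.
by rewrite mulr0 addr0.
Qed.

Let By2 : {in predC1 y, forall u, B u y = A u y + x * A u y'}.
Proof.
move=> [p|m] /=; last by rewrite /B mulr0 addr0.
rewrite /B inE xpair_eqE => yp; rewrite (negPf yp) /=.
have {yp} pc1 : p != c.+1 by apply: contraNneq yp => ->.
have [pc|pc] := ltnP c.+1 p.
  rewrite ltnW // (@growth_lower c _ _ [:: p] [::]) //=.
    by rewrite inE eq_sym.
  by rewrite inE (ltn_eqF (ltnW pc)) orbT.
by rewrite ltnNge -ltnS ltn_neqAle pc1 pc /= mulr0 addr0.
Qed.

Let Buv : {in predC1 y &, forall u v, B u v = A u v}.
Proof.
move=> u v; rewrite /B !inE => uy vy; case: ifP => // _.
case: u v uy vy => [p|m] [q|m'] //= py qy.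
  rewrite (@growth_notin c) // !inE negb_or.
  by apply/andP; split; [apply: contraNneq py|apply: contraNneq qy] => <-.
by rewrite (@growth_notin c) // inE; apply: contraNneq py => <-.
Qed.

Let B_neq u v : (u, v) != (y, y') -> growth_entry t.+1 u v = B u v.
Proof. by rewrite /B => /negPf->. Qed.

Lemma growth_entry_notin n l : y \notin l ->
  pfs (growth_entry t.+1) n l = pfs (growth_entry t) n l.
Proof.
move=> yl; apply: eq_pfs => u v ul vl; rewrite B_neq ?Buv // ?inE.
- by apply: contraNneq yl => <-.
- by apply: contraNneq yl => <-.
by apply: contraNneq yl => -[<- _].
Qed.

Lemma growth_entry_lin n l1 l2 :
    y \notin l1 -> y \notin l2 -> (0 < c)%N \/ (y' \notin l1 ++ l2) ->
  pfs (growth_entry t.+1) n (l1 ++ y :: l2) =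
    pfs A n (l1 ++ y :: l2) + x * pfs A n (l1 ++ y' :: l2).
Proof.
move=> yl1 yl2 c0; rewrite -(pfs_lin n By1 By2 Buv) //.
apply: eq_pfs => u v _ vl; have [[uE vE]|] := eqVneq (u, v) (y, y'); last first.
  exact: B_neq.
rewrite {}vE in vl *; rewrite {}uE {u v}.
rewrite /B eqxx /= ltnSn; case: c0 => [c0|].
  by rewrite (@growth_stuck c) // !inE eqxx orbT.
rewrite mem_cat negb_or => /andP[yl1' yl2']; move: vl.
rewrite mem_cat inE (negPf yl1') (negPf yl2') orbF => /eqP[/eqP].
by rewrite ltn_eqF.
Qed.

Lemma growth_entry_bump n l1 l2 : c = 0%N -> uniq (l1 ++ y :: y' :: l2) ->
  pfs (growth_entry t.+1) n.+1 (l1 ++ y :: y' :: l2) =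
    pfs A n.+1 (l1 ++ y :: y' :: l2) + x * pfs A n (l1 ++ l2).
Proof.
move=> c0 ul; rewrite (@pfs_bump _ _ B _ x) //; last first.
  rewrite /B eqxx /= ltnSn (@growth_lower c _ _ [::] [:: c]) //= ?c0 //.
  by rewrite growth_00 mulr1.
move: ul; rewrite (uniq_catCA l1 [:: y; y'] l2) /= inE negb_or => /and3P[].
rewrite mem_cat negb_or => /and3P[yy' yl1 yl2] _ _.
rewrite (pfs_lin _ By1 By2 Buv) // ?inE ?negb_or ?yy' //.
rewrite [pfs A _ (l1 ++ y' :: _)]pfs_adj_eq /= ?ltnn // mulr0 addr0.
congr (_ + x * _); apply: eq_pfs => u v ul vl; apply: Buv; rewrite inE.
  by apply: contraTneq ul => ->; rewrite mem_cat negb_or yl1.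
by apply: contraTneq vl => ->; rewrite mem_cat negb_or yl1.
Qed.
End Step.

(** By induction on the time, using linearity in the index of the part c + 1. If
    the step cannot happen since c is a part, the linear term has a repeated index;
    if c = 0 and both 1 and 0 are parts, the correction at (1, 0) supplies the
    missing term. *)
Theorem growth_pfs n t lam mu :
    sorted gtn lam -> sorted gtn mu -> 0%N \notin mu ->
    (size lam + size mu = n.*2)%N ->
  growth mu t lam = pfs (growth_entry t) n (indices lam mu).
Proof.
move=> slam smu mu0 sz; elim: t n lam slam sz => [|t IH] n lam slam sz.
  exact: growth_pfs0.
have gtr : transitive gtn by apply: rev_trans ltn_trans.
pose c := cont t.+1; have cE : c = cont t.+1 by [].
have inlE k l : (inl k \in indices l mu) = (k \in l).
  rewrite mem_cat mem_map => [|? ? []//]; rewrite orbC.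
  by case: mapP => // -[].
have [clam|clam] := boolP (c.+1 \in lam); last first.
  by rewrite (growth_notin _ cE) // (growth_entry_notin cE) ?inlE // -IH.
case/splitPr: clam slam sz => l1 l2.
move=> slam; move: (slam); rewrite sorted_pairwise // pairwise_cat allrel_consr /=.
move=> /and3P[/andP[/allP cl1 al12] pl1 /andP[/allP cl2 pl2]] sz.
have c1l1 : c.+1 \notin l1 by apply/negP => /cl1 /=; rewrite ltnn.
have c1l2 : c.+1 \notin l2 by apply/negP => /cl2 /=; rewrite ltnn.
have cl1' : c \notin l1 by apply/negP => /cl1 /=; rewrite ltnNge leqnSn.
have indE p l : indices (l1 ++ p :: l) mu = map inl l1 ++ inl p :: indices l mu.
  by rewrite /indices map_cat /= -catA.
have inl1 k : ((inl k : nat + nat) \in [seq inl i | i <- l1]) = (k \in l1).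
  by rewrite mem_map // => ? ? [].
have [cl2'|cl2'] := boolP (c \in l2).
  have [l3 l2E] : exists l3, l2 = c :: l3.
    case: l2 {slam sz al12 c1l2} cl2' cl2 pl2 => // q l3.
    rewrite inE => /predU1P[<-|cl3] cl2 /= /andP[/allP ql3 _]; first by exists l3.
    have /= := cl2 q (mem_head _ _); have /= := ql3 _ cl3; lia.
  rewrite {}l2E in slam sz cl2 al12 pl2 c1l2 *; have [c0|c0] := posnP c.
    have l30 : l3 = [::].
      case: l3 {slam sz cl2 al12 c1l2} pl2 => // q l3 /= /andP[/andP[]].
      by rewrite c0.
    rewrite {}l30 in slam sz cl2 al12 pl2 c1l2 *.
    case: n sz => [|n] sz; first by rewrite size_cat /= in sz; lia.
    rewrite (growth_lower _ cE) // ?c0 //.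
    (* The part 1 becomes a second 0, and zeros do not count. *)
    have -> : l1 ++ [:: 0; 0]%N = rcons (rcons l1 0%N) 0%N.
      by rewrite -!cats1 -catA.
    rewrite !growth_rcons0 -c0 indE (growth_entry_bump cE) //.
      rewrite -[_ ++ _ :: _ :: _](indE c.+1 [:: c]) -/(indices l1 mu).
      congr (_ + _ * _); apply: IH => //.
        by rewrite sorted_pairwise.
      by rewrite size_cat /= in sz; lia.
    rewrite -[_ ++ _ :: _ :: _](indE c.+1 [:: c]) /indices cat_uniq.
    rewrite map_inj_uniq ?map_inj_uniq; last 2 first.
    - by move=> ? ? [].
    - by move=> ? ? [].
    rewrite rev_uniq !(sorted_uniq gtr) //; [|by move=> ?; rewrite /= ltnn..].
    by rewrite andbT; apply/hasPn => z /mapP[m _ ->]; apply/mapP => -[].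
  rewrite (growth_stuck _ cE) ?mem_cat ?inE ?eqxx ?orbT //.
  rewrite indE (growth_entry_lin cE) ?inl1 ?inlE //; last by left.
  rewrite [X in _ + _ * X]pfs_adj_eq /= ?ltnn // mulr0 addr0.
  by rewrite -[X in pfs _ _ X]indE; apply: IH.
rewrite (growth_lower _ cE) // ?mem_cat ?negb_or ?cl1' ?cl2' ?orbT // indE.
rewrite (growth_entry_lin cE) ?inl1 ?inlE //; last first.
  have [c0|] := posnP c; [right|by left].
  by rewrite mem_cat inl1 inlE negb_or cl1'.
rewrite -!indE; congr (_ + _ * _); apply: IH.
- by [].
- by rewrite -sz !size_cat.
- have cl1'' : all (gtn^~ c) l1 by apply/allP => q /cl1 /= /ltnW.
  rewrite sorted_pairwise // pairwise_cat allrel_consr /= -andbA.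
  apply/and5P; split=> //; apply/allP => q ql2.
  have qc : q != c by apply: contraNneq cl2' => <-.
  by have /= := cl2 q ql2; lia.
- by rewrite -sz !size_cat.
Qed.

End Growth.

(** * Increasing fillings and growth *)

Section StrictParts.
Implicit Types lam mu : seq nat.

(** Strict partitions with any number of trailing zeros: the truncated predecessor
    allows 0 after 0. *)
Definition strict_parts lam := forall i, (nth 0 lam i.+1 <= (nth 0 lam i).-1)%N.

(** In a shifted diagram the last columns of the nonempty rows weakly decrease. *)
Lemma strict_parts_sub lam i j : strict_parts lam -> (i <= j)%N ->
  (nth 0 lam j <= nth 0 lam i - (j - i))%N.
Proof.
move=> slam; elim: j => [|j IH] ij; first by case: i ij => //; lia.
have [->|ji] := eqVneq i j.+1; first by lia.
by have := slam j; have := IH ltac:(lia); lia.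
Qed.

Lemma nth_filter_pos lam i : strict_parts lam ->
  nth 0%N [seq p <- lam | 0 < p]%N i = nth 0%N lam i.
Proof.
elim: lam i => [|p lam IH] i // slam.
have slam' : strict_parts lam by move=> k; apply: (slam k.+1).
case: p slam => [|p] slam /=; last by case: i => //= i; apply: IH.
by rewrite IH //; have /= := strict_parts_sub slam (leq0n i.+1);
  have /= := strict_parts_sub slam (leq0n i); lia.
Qed.

Lemma nth_lower c lam i :
  nth 0%N (lower c lam) i =
    if nth 0%N lam i == c.+1 then c else nth 0%N lam i.
Proof.
have [il|il] := ltnP i (size lam); first by rewrite (nth_map 0%N).
by rewrite !nth_default ?size_map.
Qed.

Lemma mem_nth_pos lam c : (0 < c)%N ->
  reflect (exists i, nth 0%N lam i = c) (c \in lam).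
Proof.
move=> c0; apply: (iffP (nthP 0%N)) => -[i]; first by exists i.
move=> ic; exists i => //; rewrite ltnNge; apply: contraL c0 => il.
by rewrite -ic nth_default.
Qed.

Lemma strict_parts_lower c lam : removable c lam -> strict_parts lam ->
  strict_parts (lower c lam).
Proof.
move=> /andP[_ clam] slam i; rewrite !nth_lower; have := slam i.
have : c = 0%N \/ nth 0%N lam i.+1 <> c.
  case/orP: clam => [/eqP|clam]; first by left.
  have [|c0] := posnP c; [by left|right=> ic].
  by case/negP: clam; apply/mem_nth_pos => //; exists i.+1.
by case: eqP; case: eqP; lia.
Qed.

Lemma eq_from_nth_pos lam mu : 0%N \notin lam -> 0%N \notin mu ->
  (forall i, nth 0%N lam i = nth 0%N mu i) -> lam = mu.
Proof.
move=> lam0 mu0 E; apply: (eq_from_nth (x0 := 0%N)) => //.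
have le s s' : 0%N \notin s' -> (forall i, nth 0%N s i = nth 0%N s' i) ->
    (size s' <= size s)%N.
  move=> s'0 E'; rewrite leqNgt; apply: contra s'0 => ss'.
  by rewrite -(nth_default 0%N (leqnn (size s))) E' mem_nth.
by apply/eqP; rewrite eqn_leq !le.
Qed.

End StrictParts.

Section Tableaux.
Variables (R : comNzRingType) (cont : nat -> nat) (w : nat -> R) (K T : nat).
Implicit Types lam mu : seq nat.

Local Notation box := ('I_K * 'I_K)%type.
Local Notation filling := {ffun box -> 'I_T.+1}.

Definition in_skew lam mu (i j : nat) :=
  (i + nth 0 mu i <= j < i + nth 0 lam i)%N.

(** Fillings of a square grid, 0 meaning an empty box. A value [v] may only be put
    in a box of content [cont v]. *)
Definition tableau lam mu t (g : filling) : Prop :=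
  [/\ forall b : box, (0 < g b)%N = in_skew lam mu b.1 b.2,
      forall b : box, (g b <= t)%N,
      forall b : box, (0 < g b)%N -> cont (g b) = (b.2 - b.1)%N,
      forall b b' : box, b.1 = b'.1 -> (b.2 < b'.2)%N -> (0 < g b)%N ->
        (0 < g b')%N -> (g b < g b')%N
    & forall b b' : box, b.2 = b'.2 -> (b.1 < b'.1)%N -> (0 < g b)%N ->
        (0 < g b')%N -> (g b < g b')%N].

Definition tabsum lam mu t : R :=
  \sum_(g : filling | `[< tableau lam mu t g >])
    \prod_(b : box | (0 < g b)%N) w (g b).

Definition fits lam := forall i, (0 < nth 0 lam i)%N -> (i + nth 0 lam i <= K)%N.

Definition subparts mu lam := forall i, (nth 0 mu i <= nth 0 lam i)%N.

(** Chains start at [mu] and never shrink. *)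
Lemma growth_not_sub t lam mu i : strict_parts lam ->
  (nth 0 lam i < nth 0 mu i)%N -> growth cont w mu t lam = 0.
Proof.
elim: t lam => [|t IH] lam slam il.
  rewrite /growth; case: eqP => // E; move: il.
  by rewrite -E nth_filter_pos // ltnn.
rewrite growthS IH // add0r; case: ifP => // rm; rewrite IH ?mulr0 //.
  exact: strict_parts_lower.
by rewrite nth_lower; case: eqP => [E|_] //; rewrite E in il; apply: ltnW.
Qed.

Lemma tabsum0 lam mu : strict_parts lam -> fits lam -> subparts mu lam ->
  0%N \notin mu -> tabsum lam mu 0 = growth cont w mu 0 lam.
Proof.
move=> slam flam sml mu0; rewrite /growth.
have noskew (g : filling) (b : box) :
    tableau lam mu 0 g -> in_skew lam mu b.1 b.2 = false.
  by case=> gB gt _ _ _; rewrite -gB; have := gt b; rewrite leqn0 => /eqP->.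
case: eqP => [E|lm].
  have eqn i : nth 0%N lam i = nth 0%N mu i by rewrite -E nth_filter_pos.
  rewrite /tabsum (big_pred1 [ffun=> ord0]).
    by rewrite big_pred0 // => b; rewrite ffunE.
  move=> g; apply/asboolP/eqP => [[_ g0 _ _ _]|->].
    by apply/ffunP => b; rewrite ffunE; apply/val_inj/eqP; rewrite -leqn0 g0.
  split=> [b|b|b|b b'|b b']; rewrite !ffunE // /in_skew eqn.
  by apply/esym/negbTE; rewrite negb_and; lia.
rewrite /tabsum big_pred0 // => g; apply/negP => /asboolP gP; apply: lm.
apply: eq_from_nth_pos => // [|i]; first by rewrite mem_filter ltnn.
rewrite nth_filter_pos //; apply/eqP; rewrite eqn_leq sml andbT leqNgt.
apply/negP => il; have fi := flam i (leq_ltn_trans (leq0n _) il).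
have iK : (i < K)%N by lia.
have jK : (i + (nth 0 lam i).-1 < K)%N by lia.
have := noskew g (Ordinal iK, Ordinal jK) gP.
by rewrite /in_skew /=; lia.
Qed.

Section Step.
Variables (lam mu : seq nat) (t : nat).
Hypotheses (slam : strict_parts lam) (smu : strict_parts mu).
Hypotheses (flam : fits lam) (tT : (t < T)%N).
Let c := cont t.+1.
Local Notation L := (nth 0%N lam).
Local Notation M := (nth 0%N mu).

(** A box with the largest value allowed has no neighbour to the right or below. *)
Lemma top_corner (g : filling) (b : box) :
    tableau lam mu t.+1 g -> g b = t.+1 :> nat ->
  [/\ L b.1 = c.+1, b.2 = (b.1 + c)%N :> nat & removable c lam].
Proof.
case=> gB gt gc gr gcol gb.
have gb0 : (0 < g b)%N by rewrite gb.
have bc : b.2 = (b.1 + c)%N :> nat.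
  have := gc b gb0; rewrite gb -/c => ->; move: gb0.
  by rewrite gB /in_skew; lia.
have := gb0; rewrite gB bc /in_skew => /andP[bM bL].
have Lb : L b.1 = c.+1.
  apply/eqP; rewrite eqn_leq; apply/andP; split; last by lia.
  rewrite leqNgt; apply/negP => cL.
  have jK : (b.1 + c.+1 < K)%N by have := flam (i := b.1); lia.
  pose b' : box := (b.1, Ordinal jK).
  have gb' : (0 < g b')%N by rewrite gB /in_skew /=; lia.
  by have := gr b b' erefl ltac:(rewrite /= bc; lia) gb0 gb'; have := gt b'; lia.
split=> //; rewrite /removable.
have -> : c.+1 \in lam by apply/mem_nth_pos => //; exists b.1.
have [//|c0] := posnP c; rewrite /=.
apply/negP => /(mem_nth_pos _ c0)[i ic].
have ib : i = b.1.+1.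
  have := strict_parts_sub (i := i) (j := b.1) slam.
  have := strict_parts_sub (i := b.1.+1) (j := i) slam.
  have := slam b.1; lia.
subst i; have fi := flam (i := b.1.+1).
have iK : (b.1.+1 < K)%N by lia.
pose b' : box := (Ordinal iK, b.2).
have gb' : (0 < g b')%N by rewrite gB /in_skew /= bc; have := smu b.1; lia.
by have := gcol b b' erefl (ltnSn _) gb0 gb'; have := gt b'; lia.
Qed.

Lemma tableau_keep (g : filling) :
  tableau lam mu t g <->
  tableau lam mu t.+1 g /\ (forall b, g b <> t.+1 :> nat).
Proof.
split=> [[gB gt gc gr gcol]|[[gB gt gc gr gcol] gn]]; split=> //.
- by split=> // b; apply: leqW.
- by move=> b gb; have := gt b; rewrite gb ltnn.
by move=> b; have := gt b; rewrite leq_eqVlt => /predU1P[/gn|].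
Qed.

Lemma tabsum_keep :
    (forall g b, tableau lam mu t.+1 g -> g b <> t.+1 :> nat) ->
  tabsum lam mu t.+1 = tabsum lam mu t.
Proof.
move=> gn; apply: eq_bigl => g; apply/asboolP/asboolP => gP.
  by apply/tableau_keep; split=> // b; apply: gn.
by have [] := (tableau_keep g).1 gP.
Qed.

Hypothesis rem : removable c lam.
Let i0 := index c.+1 lam.

Let Li0 : L i0 = c.+1.
Proof. by apply: nth_index; case/andP: rem. Qed.

Let Li i : L i = c.+1 -> i = i0.
Proof.
move=> Lic; have := strict_parts_sub (i := i) (j := i0) slam.
have := strict_parts_sub (i := i0) (j := i) slam.
by rewrite Lic Li0; lia.
Qed.

Let i0cK : (i0 + c < K)%N.
Proof. by have := flam (i := i0); rewrite Li0; lia. Qed.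

Let i0K : (i0 < K)%N.
Proof. by apply: leq_ltn_trans i0cK; apply: leq_addr. Qed.

Let b0 : box := (Ordinal i0K, Ordinal i0cK).

Let top_b0 (g : filling) b :
  tableau lam mu t.+1 g -> g b = t.+1 :> nat -> b = b0.
Proof.
move=> gP /(top_corner gP)[/Li bi bj _]; case: b bi bj => b1 b2 /= bi bj.
by congr (_, _); apply: val_inj => //=; rewrite bj bi.
Qed.

Lemma tabsum_corner_sub : (c < M i0)%N ->
  tabsum lam mu t.+1 = tabsum lam mu t.
Proof.
move=> cM; apply: tabsum_keep => g b gP gb.
have bb0 := top_b0 gP gb; case: gP => gB _ _ _ _.
by have := gB b; rewrite gb bb0 /in_skew /=; lia.
Qed.

Let lam' := lower c lam.

Let put (h : filling) : filling :=
  [ffun b => if b == b0 then inord t.+1 else h b].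
Let clear (g : filling) : filling :=
  [ffun b => if b == b0 then ord0 else g b].

Let in_skew_lower (b : box) :
  in_skew lam' mu b.1 b.2 = (b != b0) && in_skew lam mu b.1 b.2.
Proof.
rewrite /in_skew nth_lower; case: b => b1 b2; rewrite /b0 xpair_eqE -!val_eqE /=.
case: eqP => [Lb|Lb]; first by rewrite Lb (Li Lb) eqxx /=; lia.
suff -> : val b1 == i0 = false by [].
by apply/eqP => b1E; rewrite b1E Li0 in Lb.
Qed.

Let putE h : put h b0 = t.+1 :> nat.
Proof. by rewrite ffunE eqxx inordK. Qed.

Let putN h b : b != b0 -> put h b = h b.
Proof. by rewrite ffunE => /negPf->. Qed.

Let put_tableau (h : filling) : (M i0 <= c)%N ->
  tableau lam' mu t h <-> tableau lam mu t.+1 (put h) /\ h b0 = ord0.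
Proof.
move=> Mc; split=> [[hB ht hc hr hcol]|[gP hb0]].
  have hb0 : h b0 = ord0.
    by apply: val_inj; apply/eqP; rewrite /= -leqn0 leqNgt hB in_skew_lower eqxx.
  have hb b : (0 < h b)%N -> b != b0.
    by apply: contraTneq => ->; rewrite hb0.
  split=> //; split=> [b|b|b|b b'|b b'].
  - have [->|bb] := eqVneq b b0; first by rewrite putE /in_skew /= Li0; lia.
    by rewrite putN // hB in_skew_lower bb.
  - have [->|bb] := eqVneq b b0; first by rewrite putE.
    by rewrite putN // leqW.
  - have [->|bb] := eqVneq b b0; last by rewrite putN //; apply: hc.
    by rewrite putE /= -/c; lia.
  - have [->|bb] := eqVneq b b0; have [->|b'b] := eqVneq b' b0; move=> bb'.
    + by rewrite ltnn.
    + move=> /= b'2 _; rewrite putN // hB /in_skew nth_lower -bb' /=.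
      by rewrite Li0 eqxx; lia.
    + by move=> _ _ _; rewrite putE putN // ltnS.
    + by rewrite !putN //; apply: hr.
  - have [->|bb] := eqVneq b b0; have [->|b'b] := eqVneq b' b0; move=> bb'.
    + by rewrite ltnn.
    + move=> /= b'1 _; rewrite putN // hB /in_skew -bb' /=.
      (* Rows below the corner are bounded through the lowered shape, whose
         strictness expresses that c is not a positive part. *)
      have := strict_parts_sub (strict_parts_lower rem slam) (ltnW b'1).
      by rewrite [nth _ _ i0]nth_lower Li0 eqxx -/lam'; lia.
    + by move=> _ _ _; rewrite putE putN // ltnS.
    + by rewrite !putN //; apply: hcol.
have hb b : (0 < h b)%N -> b != b0.
  by apply: contraTneq => ->; rewrite hb0.
case: (gP) => gB gt gc gr gcol; split=> [b|b|b|b b'|b b'].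
- rewrite in_skew_lower -gB; have [->|bb] := eqVneq b b0; first by rewrite hb0.
  by rewrite putN.
- have [->|bb] := eqVneq b b0; first by rewrite hb0.
  have := gt b; rewrite leq_eqVlt => /predU1P[/(top_b0 gP)/eqP|].
    by rewrite (negPf bb).
  by rewrite putN.
- by move=> h0; have := gc b; rewrite putN ?hb //; apply.
- by move=> bb' bb2 h0 h0'; have := gr b b'; rewrite !putN ?hb //; apply.
- by move=> bb' bb2 h0 h0'; have := gcol b b'; rewrite !putN ?hb //; apply.
Qed.

(** Erasing the entry of the corner is a bijection onto the tableaux of the shape
    without that corner. *)
Lemma tabsum_corner : (M i0 <= c)%N ->
  tabsum lam mu t.+1 = tabsum lam mu t + w t.+1 * tabsum lam' mu t.
Proof.
move=> Mc; rewrite {1}/tabsum (bigID (fun g : filling => g b0 == t.+1 :> nat)).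
rewrite [RHS]addrC /=; congr (_ + _); last first.
  rewrite /tabsum; apply: eq_bigl => g; apply/andP/asboolP => [[/asboolP gP /eqP gb0]|].
    by apply/tableau_keep; split=> // b gb; apply: gb0; rewrite -(top_b0 gP gb).
  by move=> /tableau_keep[gP gn]; split; [apply/asboolP|apply/eqP/gn].
rewrite (reindex_onto put clear) /= => [|g /andP[_ /eqP gb0]]; last first.
  apply/ffunP => b; rewrite !ffunE; case: eqP => // ->; apply: val_inj.
  by rewrite /= inordK // gb0.
have clearK h : (clear (put h) == h) = (h b0 == ord0).
  apply/eqP/eqP => [<-|hb0]; first by rewrite ffunE eqxx.
  by apply/ffunP => b; rewrite !ffunE; case: eqP => // ->.
rewrite /tabsum mulr_sumr; apply: eq_big => [h|h].
  rewrite clearK putE eqxx andbT; apply/andP/asboolP.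
    by case=> /asboolP gP /eqP hb0; apply/put_tableau.
  move=> /put_tableau[] // gP ->.
  by split; first exact/asboolP.
rewrite clearK => /andP[_ /eqP hb0]; rewrite (bigD1 b0) ?putE //=; congr (_ * _).
apply: eq_big => [b|b /andP[_ bb]]; last by rewrite putN.
have [->|bb] := eqVneq b b0; first by rewrite hb0 andbF.
by rewrite putN // andbT.
Qed.

End Step.

(** The tableaux are sorted by whether the value [t] is used; it can only be used
    in the unique corner of content [cont t]. *)
Theorem tabsum_growth lam mu t : strict_parts lam -> strict_parts mu ->
    0%N \notin mu -> fits lam -> subparts mu lam -> (t <= T)%N ->
  tabsum lam mu t = growth cont w mu t lam.
Proof.
move=> slam smu mu0 flam sml.
elim: t lam slam flam sml => [|t IH] lam slam flam sml tT.
  exact: tabsum0.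
rewrite growthS -IH // 1?ltnW //; case: ifP => [rem|nrem]; last first.
  rewrite addr0; apply: tabsum_keep => // g b gP gb.
  by have [_ _] := top_corner slam smu flam tT gP gb; rewrite nrem.
set c := cont t.+1 in rem *; set i0 := index c.+1 lam.
have Li0 : nth 0%N lam i0 = c.+1 by apply: nth_index; case/andP: rem.
have [cM|cM] := ltnP c (nth 0%N mu i0).
  rewrite (@growth_not_sub _ _ _ i0) ?mulr0 ?addr0 //.
  - exact: tabsum_corner_sub.
  - exact: strict_parts_lower.
  by rewrite nth_lower Li0 eqxx.
rewrite -IH 1?ltnW //.
- exact: tabsum_corner.
- exact: strict_parts_lower.
- by move=> i; rewrite nth_lower; case: eqP => [E|_]; have := flam i; lia.
move=> i; rewrite nth_lower; case: eqP => [E|_] //.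
have -> // : i = i0.
have := strict_parts_sub (i := i) (j := i0) slam.
have := strict_parts_sub (i := i0) (j := i) slam.
by rewrite E Li0; lia.
Qed.

End Tableaux.

(** * Reduction to finitely many letters *)

Section Truncation.
Variable R : comNzRingType.
Implicit Types f g : fps R.

Definition supp_below N (m : {cmonom nat}) := forall k, (N <= k)%N -> m k = 0%N.

(** Congruence modulo the variables of index at least [N]. *)
Definition eq_below N f g :=
  forall m, supp_below N m -> coefps f m = coefps g m.

Lemma eq_below_sym N f g : eq_below N f g -> eq_below N g f.
Proof. by move=> fg m mN; rewrite fg. Qed.

Lemma eq_belowD N f f' g g' :
  eq_below N f f' -> eq_below N g g' -> eq_below N (f + g) (f' + g').
Proof. by move=> ff' gg' m mN; congr (_ + _); [apply: ff'|apply: gg']. Qed.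

Lemma eq_belowM N f f' g g' :
  eq_below N f f' -> eq_below N g g' -> eq_below N (f * g) (f' * g').
Proof.
move=> ff' gg' m mN; apply: eq_fsbigr => -[d e]; rewrite inE /splittings /= => de.
have dm k : m k = (d k + e k)%N by rewrite -de cmM.
congr (_ * _); [apply: ff'|apply: gg'] => k /mN; rewrite dm => /eqP.
  by rewrite addn_eq0 => /andP[/eqP].
by rewrite addn_eq0 => /andP[_ /eqP].
Qed.

Lemma eq_below_pf N n (A B : 'M[fps R]_n.*2) :
  (forall i j, eq_below N (A i j) (B i j)) -> eq_below N (pf A) (pf B).
Proof.
move=> AB; apply: (big_ind2 (eq_below N)) => // [*|p _]; first exact: eq_belowD.
apply: eq_belowM => //; apply: (big_ind2 (eq_below N)) => // *.
exact: eq_belowM.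
Qed.

Lemma eq_belowP f g : (forall N, eq_below N f g) -> f = g.
Proof.
move=> fg; apply: fpsP => m; apply: (fg (\max_(k <- finsupp m) k).+1).
move=> k kN; apply/eqP; rewrite -[_ == _]negbK cmE_neq0; apply/negP => km.
by move: kN; rewrite ltnNge (leq_bigmax_seq _ km).
Qed.

Lemma coefps_sum (I : finType) (P : pred I) (F : I -> fps R) m :
  coefps (\sum_(i | P i) F i) m = \sum_(i | P i) coefps (F i) m.
Proof. by apply: (big_morph (fun f => coefps f m)). Qed.

Lemma prod_fps_var (I : finType) (f e : I -> nat) :
  exists2 d, \prod_i fps_var R (f i) ^+ e i = fps_mono R d &
    forall i, (e i <= d (f i))%N.
Proof.
suff [d dE dM] : exists2 d, \prod_(i <- index_enum I)
    fps_var R (f i) ^+ e i = fps_mono R d &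
  {in index_enum I, forall i, (e i <= d (f i))%N}.
  by exists d => // i; apply: dM; rewrite mem_index_enum.
elim: (index_enum I) => [|i l [d dE dM]].
  by exists mone; rewrite ?big_nil ?fps_mono1.
have [d' d'E d'i] := fps_varX R (f i) (e i).
exists (mmul d' d); first by rewrite big_cons dE d'E fps_monoM.
move=> j; rewrite inE cmM => /predU1P[->|/dM]; first by rewrite d'i leq_addr.
by move=> /leq_trans->//; rewrite leq_addl.
Qed.

End Truncation.

Section Ranks.
Variable K : nat.

(** Position of the content [q] among the boxes carrying the letter of code [x],
    and conversely; odd codes are the unmarked letters. *)
Definition rank_pos (x q : nat) := if odd x then q else (K - q)%N.
Definition rank (x c : nat) := (x * K.+1 + rank_pos x c).+1.
Definition rank_letter v := (v.-1 %/ K.+1)%N.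
Definition rank_content v := rank_pos (rank_letter v) (v.-1 %% K.+1).

Lemma rank_pos_le x c : (c <= K)%N -> (rank_pos x c <= K)%N.
Proof. by rewrite /rank_pos; case: odd => //; lia. Qed.

Lemma rank_posK x c : (c <= K)%N -> rank_pos x (rank_pos x c) = c.
Proof. by rewrite /rank_pos; case: odd => //; lia. Qed.

Lemma rankK x c : (c <= K)%N -> rank_letter (rank x c) = x.
Proof.
move=> cK; rewrite /rank_letter /rank /= divnMDl // divn_small ?addn0 //.
exact: rank_pos_le.
Qed.

Lemma rank_contentK x c : (c <= K)%N -> rank_content (rank x c) = c.
Proof.
move=> cK; rewrite /rank_content rankK // /rank /= modnMDl modn_small.
  exact: rank_posK.
exact: rank_pos_le.
Qed.

Lemma rank_letterK v : (0 < v)%N -> rank (rank_letter v) (rank_content v) = v.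
Proof.
case: v => // v _; rewrite /rank rank_posK /rank_letter /= -?divn_eq //.
by rewrite -ltnS ltn_pmod.
Qed.

Lemma rank_le x c N : (c <= K)%N -> (rank x c <= N * K.+1)%N = (x < N)%N.
Proof.
move=> /(rank_pos_le x) cK; rewrite /rank; case: (ltnP x N) => Nx.
  by have := leq_mul Nx (leqnn K.+1); lia.
by have := leq_mul Nx (leqnn K.+1); lia.
Qed.

Lemma rank_lt x y c c' : (c <= K)%N -> (c' <= K)%N ->
  (rank x c < rank y c')%N =
    (x < y)%N || (x == y) && (if odd x then c < c' else c' < c)%N.
Proof.
move=> cK c'K; have := rank_pos_le x cK; have := rank_pos_le y c'K.
rewrite /rank ltnS; case: (ltngtP x y) => xy /=; try by nia.
by rewrite {}xy ltn_add2l /rank_pos; case: odd => //; lia.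
Qed.

End Ranks.

Definition letter_code (x : letter) : nat := (x.1.*2 + x.2)%N.
Definition code_letter (x : nat) : letter := (x./2, odd x).

Lemma letter_codeK : cancel letter_code code_letter.
Proof. by case=> k [] /=; rewrite /code_letter /letter_code /=; congr (_, _); lia. Qed.

Lemma half_letter_code (x : letter) : (letter_code x)./2 = absl x.
Proof. by case: x => k [] /=; rewrite /letter_code /absl /=; lia. Qed.

Lemma code_letterK : cancel code_letter letter_code.
Proof. by move=> x; rewrite /letter_code /= addnC odd_double_half. Qed.

Lemma le_letter_code (x y : letter) :
  (x <= y)%O = (letter_code x <= letter_code y)%N.
Proof.
case: x y => [k b] [l c]; rewrite lexi_pair /letter_code /=.
by rewrite !leEnat; case: b c => [] [] /=; lia.
Qed.

Lemma mem_SD lam i j : ((i, j) \in SD lam) = (i <= j < i + nth 0 lam i)%N.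
Proof.
apply/imfset2P/idP => [[i' + [j' + [-> ->]]]|ij].
  by rewrite /= !mem_iota.
exists i; rewrite /= ?mem_iota /=; last first.
  by exists j; rewrite //= mem_iota.
rewrite add0n ltnNge; apply/negP => /(nth_default 0%N) lam0.
by move: ij; rewrite lam0; lia.
Qed.

Lemma odd_letter_code (x : letter) : odd (letter_code x) = x.2.
Proof. by case: x => k b; rewrite /letter_code oddD odd_double oddb. Qed.

(** With the content increasing, an equal pair of letters has increasing ranks
    exactly when the letter is unmarked: rows may repeat unmarked letters only. *)
Lemma rank_row K (x y : letter) c c' : (c < c')%N -> (c' <= K)%N ->
  (rank K (letter_code x) c < rank K (letter_code y) c')%N =
    (x <= y)%O && (x.2 || (x != y)).
Proof.
move=> cc' c'K; rewrite rank_lt // ?(leq_trans (ltnW cc')) // le_letter_code.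
rewrite odd_letter_code -(inj_eq (can_inj letter_codeK)) cc' (leq_gtF (ltnW cc')).
by case: ltngtP => //=; case: x.2.
Qed.

(** Same with the content decreasing: columns may repeat marked letters only. *)
Lemma rank_col K (x y : letter) c c' : (c' < c)%N -> (c <= K)%N ->
  (rank K (letter_code x) c < rank K (letter_code y) c')%N =
    (x <= y)%O && (~~ x.2 || (x != y)).
Proof.
move=> cc' c'K; rewrite rank_lt // ?(leq_trans (ltnW cc')) // le_letter_code.
rewrite odd_letter_code -(inj_eq (can_inj letter_codeK)) cc' (leq_gtF (ltnW cc')).
by case: ltngtP => //=; case: x.2.
Qed.

Section Tableaux_of_SQ.
Local Open Scope classical_set_scope.
Variables (lam mu L M : seq nat) (st : ST lam mu nat) (d K N : nat).
Variable a : nat -> nat.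
Hypothesis skewE :
  forall i j, ((i, j) \in SDskew lam mu) = in_skew L M i (j + d).
Hypothesis skewd : forall i j, in_skew L M i j -> (d <= j)%N.
Hypothesis Lfits : fits K.+1 L.

Let T := (N.*2 * K.+1)%N.
Let cell := SDskew lam mu.
Let box := ('I_K.+1 * 'I_K.+1)%type.
Let row (b : cell) : nat := (val b).1.
Let col (b : cell) : nat := (val b).2.
Let ct (b : cell) := (col b + d - row b)%N.

Hypothesis stE : forall b, st b = a (ct b).
Hypothesis st_gt0 : forall b, (0 < st b)%N.

Let wt v : fps int := fps_var int (rank_letter K v)./2 ^+ a (rank_content K v).

(** The columns are shifted by [d] so that a one-row shape of length l - m, whose
    exponents belong to the contents m, ..., l - 1, can be placed as the row of
    length l without its first m boxes. *)
Let phi (b : cell) : box := (inord (row b), inord (col b + d)).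

Let cell_in (b : cell) : in_skew L M (row b) (col b + d).
Proof. by rewrite -skewE /row /col -surjective_pairing; apply: valP. Qed.

Let cell_bounds (b : cell) :
  [/\ (row b <= K)%N, (col b + d <= K)%N & (row b <= col b + d)%N].
Proof.
by have := cell_in b; rewrite /in_skew; have := Lfits (i := row b); split; lia.
Qed.

Let phi1 b : (phi b).1 = row b :> nat.
Proof. by rewrite /= inordK // ltnS; have [] := cell_bounds b. Qed.

Let phi2 b : (phi b).2 = (col b + d)%N :> nat.
Proof. by rewrite /= inordK // ltnS; have [] := cell_bounds b. Qed.

Let phi_in b : in_skew L M (phi b).1 (phi b).2.
Proof. by rewrite phi1 phi2. Qed.

Let cell_eq (b c : cell) : row b = row c -> col b = col c -> b = c.
Proof.
move=> bc1 bc2; apply: val_inj.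
by rewrite [LHS]surjective_pairing [RHS]surjective_pairing; congr (_, _).
Qed.

Let phi_inj : injective phi.
Proof.
move=> b c bc; apply: cell_eq; first by rewrite -phi1 bc phi1.
by apply/eqP; rewrite -(eqn_add2r d) -!phi2 bc.
Qed.

Let phiP (b' : box) : in_skew L M b'.1 b'.2 -> exists b, b' = phi b.
Proof.
move=> b'S; have db := skewd b'S.
have bS : (val b'.1, (b'.2 - d)%N) \in SDskew lam mu by rewrite skewE subnK.
exists [` bS]%fset.
have E1 : b'.1 = (phi [` bS]%fset).1 by apply: ord_inj; rewrite phi1.
have E2 : b'.2 = (phi [` bS]%fset).2.
  by apply: ord_inj; rewrite phi2 /col /= subnK.
rewrite [LHS]surjective_pairing [RHS]surjective_pairing.
exact: (f_equal2 pair E1 E2).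
Qed.

Let ct_le b : (ct b <= K)%N.
Proof. by have [] := cell_bounds b; rewrite /ct; lia. Qed.

Let ct_row b c : row b = row c -> (col b < col c)%N ->
  (ct b < ct c)%N.
Proof. by move=> bc ?; have [_ _] := cell_bounds b; rewrite /ct bc; lia. Qed.

Let ct_col b c : col b = col c -> (row b < row c)%N ->
  (ct c < ct b)%N.
Proof. by move=> bc ?; have [_ _] := cell_bounds c; rewrite /ct bc; lia. Qed.

Let read (g : {ffun box -> 'I_T.+1}) : ST lam mu letter :=
  [ffun b : cell => code_letter (rank_letter K (g (phi b)))].

Let tab (g : {ffun box -> 'I_T.+1}) := @tableau (rank_content K) K.+1 T L M T g.

Let tab_rank g b : tab g -> g (phi b) = rank K (letter_code (read g b)) (ct b) :> nat.
Proof.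
case=> gB _ gc _ _; have gb : (0 < g (phi b))%N by rewrite gB.
rewrite ffunE code_letterK; have := gc _ gb.
by rewrite phi1 phi2 -/(ct b) => <-; rewrite rank_letterK.
Qed.

Let read_QSST g : tab g -> QSST lam mu (read g).
Proof.
move=> gP; have gb0 b : (0 < g (phi b))%N by case: gP => ->.
have rowP b c : row b = row c -> (col b < col c)%N ->
    (read g b <= read g c)%O && ((read g b).2 || (read g b != read g c)).
  move=> bc1 bc2; rewrite -(@rank_row K _ _ _ _ (ct_row bc1 bc2)) // -!tab_rank //.
  case: (gP) => _ _ _ + _; apply=> //; last by rewrite !phi2 ltn_add2r.
  by apply: ord_inj; rewrite !phi1.
have colP b c : col b = col c -> (row b < row c)%N ->
    (read g b <= read g c)%O && (~~ (read g b).2 || (read g b != read g c)).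
  move=> bc1 bc2; rewrite -(@rank_col K _ _ _ _ (ct_col bc1 bc2)) // -!tab_rank //.
  case: (gP) => _ _ _ _; apply=> //; last by rewrite !phi1.
  by apply: ord_inj; rewrite !phi2 bc1.
have row_le b c : row b = row c -> (col b <= col c)%N -> (read g b <= read g c)%O.
  move=> bc1; rewrite leq_eqVlt => /predU1P[bc2|bc2].
    by rewrite (cell_eq bc1 bc2) lexx.
  by have /andP[] := rowP _ _ bc1 bc2.
have col_le b c : col b = col c -> (row b <= row c)%N -> (read g b <= read g c)%O.
  move=> bc1; rewrite leq_eqVlt => /predU1P[bc2|bc2].
    by rewrite (cell_eq bc2 bc1) lexx.
  by have /andP[] := colP _ _ bc1 bc2.
have no_row k b c : row b = row c ->
    read g b = (k, false) -> read g c = (k, false) -> (col c <= col b)%N.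
  move=> bc1 bk ck; rewrite leqNgt; apply/negP => bc2.
  by have := rowP _ _ bc1 bc2; rewrite bk ck => /andP[_ /eqP].
have no_col k b c : col b = col c ->
    read g b = (k, true) -> read g c = (k, true) -> (row c <= row b)%N.
  move=> bc1 bk ck; rewrite leqNgt; apply/negP => bc2.
  by have := colP _ _ bc1 bc2; rewrite bk ck => /andP[_ /eqP].
have row_uniq k b c : row b = row c ->
    read g b = (k, false) -> read g c = (k, false) -> b = c.
  move=> bc1 bk ck; apply: (cell_eq bc1); apply: anti_leq.
  by rewrite (no_row _ _ _ bc1 bk ck) (no_row _ _ _ (esym bc1) ck bk).
have col_uniq k b c : col b = col c ->
    read g b = (k, true) -> read g c = (k, true) -> b = c.
  move=> bc1 bk ck; suff rbc : row b = row c by apply: cell_eq rbc bc1.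
  apply: anti_leq.
  by rewrite (no_col _ _ _ bc1 bk ck) (no_col _ _ _ (esym bc1) ck bk).
exact: And4 row_le col_le row_uniq col_uniq.
Qed.

Let read_lt g b : tab g -> (absl (read g b) < N)%N.
Proof.
move=> gP; case: (gP) => _ /(_ (phi b)) + _ _ _.
rewrite tab_rank // rank_le // /letter_code /absl.
by case: (read g b) => k b' /=; lia.
Qed.

Let read_inj g g' : tab g -> tab g' -> read g = read g' -> g = g'.
Proof.
move=> gP gP' E; apply/ffunP => b'; apply: val_inj => /=.
have [/phiP[b ->]|b'S] := boolP (in_skew L M b'.1 b'.2).
  by rewrite !tab_rank // E.
case: gP gP' => + _ _ _ _ [+ _ _ _ _] => /(_ b') gb /(_ b') gb'.
by move: gb gb'; rewrite (negPf b'S); case: (g b') => -[] // ?; case: (g' b') => -[].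
Qed.

Let write (m : ST lam mu letter) : {ffun box -> 'I_T.+1} :=
  [ffun b' => if [pick b | phi b == b'] is Some b
              then inord (rank K (letter_code (m b)) (ct b)) else ord0].

Let writeE (m : ST lam mu letter) b : (forall b, absl (m b) < N)%N ->
  write m (phi b) = rank K (letter_code (m b)) (ct b) :> nat.
Proof.
move=> mN; rewrite ffunE; case: pickP => [c /eqP/phi_inj ->|/(_ b)]; last by rewrite eqxx.
rewrite inordK // ltnS rank_le //; have := mN b.
by rewrite /letter_code /absl; case: (m b) => k [] /=; lia.
Qed.

Let write_tab m : QSST lam mu m -> (forall b, absl (m b) < N)%N -> tab (write m).
Proof.
move=> [mr mc mrk mck] mN.
have wB (b' : box) : (0 < write m b')%N = in_skew L M b'.1 b'.2.
  apply/idP/idP => [|/phiP[b ->]]; last by rewrite writeE.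
  by rewrite ffunE; case: pickP => [b /eqP<-|//].
have row_lt b c : row b = row c -> (col b < col c)%N ->
    (write m (phi b) < write m (phi c))%N.
  move=> bc1 bc2; rewrite !writeE // (@rank_row K _ _ _ _ (ct_row bc1 bc2)) //.
  rewrite mr //=; last exact: ltnW.
  have [//|mb] := boolP (m b).2; apply/eqP => mbc.
  have bE : m b = ((m b).1, false) by rewrite -(negPf mb) -surjective_pairing.
  have cE : m c = ((m b).1, false) by rewrite -mbc.
  by move: bc2; rewrite (mrk _ _ _ bc1 bE cE) ltnn.
have col_lt b c : col b = col c -> (row b < row c)%N ->
    (write m (phi b) < write m (phi c))%N.
  move=> bc1 bc2; rewrite !writeE // (@rank_col K _ _ _ _ (ct_col bc1 bc2)) //.
  rewrite mc //=; last exact: ltnW.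
  have [mb|//] := boolP (m b).2; apply/eqP => mbc.
  have bE : m b = ((m b).1, true) by rewrite -mb -surjective_pairing.
  have cE : m c = ((m b).1, true) by rewrite -mbc.
  by move: bc2; rewrite (mck _ _ _ bc1 bE cE) ltnn.
split=> [//|b'|b'|b' c'|b' c'].
- by rewrite -ltnS.
- rewrite wB => /phiP[b ->]; rewrite writeE // rank_contentK // phi1 phi2.
  by [].
- move=> bc1 bc2; rewrite !wB => /phiP[b bE] /phiP[c cE]; subst b' c'.
  apply: row_lt; last by move: bc2; rewrite !phi2 ltn_add2r.
  by rewrite -!phi1 bc1.
move=> bc1 bc2; rewrite !wB => /phiP[b bE] /phiP[c cE]; subst b' c'.
apply: col_lt; last by move: bc2; rewrite !phi1.
by apply/eqP; rewrite -(eqn_add2r d) -!phi2 bc1.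
Qed.

Let writeK m : QSST lam mu m -> (forall b, absl (m b) < N)%N -> read (write m) = m.
Proof.
move=> mQ mN; apply/ffunP => b; rewrite ffunE writeE // rankK //.
exact: letter_codeK.
Qed.

Let SQ_term_read g : tab g ->
  SQ_term st (read g) = \prod_(b' : box | (0 < g b')%N) wt (g b').
Proof.
move=> gP; have gB : forall b', (0 < g b')%N = in_skew L M b'.1 b'.2 by case: gP.
transitivity (\prod_(b' in [set phi b | b : cell]%SET) wt (g b')); last first.
  apply: eq_bigl => b'; rewrite gB; apply/imsetP/idP => [[b _ ->]|/phiP[b ->]] //.
  by exists b.
rewrite big_imset /=; last by move=> b c _ _; apply: phi_inj.
apply: eq_bigr => b _; rewrite stE /wt (tab_rank b gP).
by rewrite (rankK _ (ct_le b)) (rank_contentK _ (ct_le b)) half_letter_code.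
Qed.

(** Tableaux with letters of absolute value at most [N] correspond to fillings by
    ranks; the others do not contribute to monomials in the first [N] variables,
    because the exponents are positive. *)
Lemma SQ_tabsum :
  eq_below N (SQ st) (tabsum (rank_content K) wt K.+1 T L M T).
Proof.
move=> m mN; rewrite /tabsum coefps_sum /=.
(* A letter outside the range would contribute a variable absent from m. *)
pose D := QSST lam mu `&` [set x | forall b, (absl (x b) < N)%N].
rewrite -(fsbig_widen D); last 2 first.
- by move=> x [].
- move=> x [xQ xD] /=; have [e eE ex] := prod_fps_var int (absl \o x) st.
  rewrite /SQ_term eE /=; case: eqP => // me; case: xD; split=> // b.
  rewrite ltnNge; apply/negP => /mN; rewrite me => eb.
  by have := ex b; rewrite /= eb leqNgt st_gt0.
rewrite (@reindex_fsbig _ _ _ _ _ read [set` fun g => `[< tab g >]]).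
  rewrite -(@bigfs _ _ _ _ (index_enum {ffun box -> 'I_T.+1})); last 2 first.
  - exact: index_enum_uniq.
  - by move=> g _; rewrite mem_index_enum.
  by apply: eq_bigr => g /asboolP gP; rewrite SQ_term_read.
split=> [g /asboolP gP|g g'|x [xQ xN]].
- by split; [apply: read_QSST|move=> b; apply: read_lt].
- by rewrite !inE => /asboolP gP /asboolP gP'; apply: read_inj.
by exists (write x); [apply/asboolP/write_tab|apply: writeK].
Qed.

End Tableaux_of_SQ.

(** * The Pfaffian formula for Schur Q-type functions *)

Lemma mem_SDskew lam mu i j :
  ((i, j) \in SDskew lam mu) = in_skew lam mu i j.
Proof. by rewrite in_fsetD !mem_SD /in_skew; lia. Qed.

Lemma strict_parts_sorted lam : sorted gtn lam -> strict_parts lam.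
Proof.
move=> slam i; have [il|il] := ltnP i.+1 (size lam); last by rewrite nth_default.
have gtr : transitive gtn by apply: rev_trans ltn_trans.
by have /= := sorted_ltn_nth gtr 0%N slam i i.+1 (ltnW il) il (ltnSn i); lia.
Qed.

Section Entries.
Variables (K N : nat) (a : nat -> nat).
Let T := (N.*2 * K.+1)%N.
Let wt v : fps int := fps_var int (rank_letter K v)./2 ^+ a (rank_content K v).
Local Notation G := (growth (rank_content K) wt).

Lemma SQ_growth lam mu L M d (st : ST lam mu nat) :
    (forall i j, ((i, j) \in SDskew lam mu) = in_skew L M i (j + d)) ->
    (forall i j, in_skew L M i j -> (d <= j)%N) ->
    (forall b, st b = a ((val b).2 + d - (val b).1)%N) ->
    (forall b, (0 < st b)%N) ->
    strict_parts L -> strict_parts M -> 0%N \notin M -> fits K.+1 L ->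
    subparts M L ->
  eq_below N (SQ st) (G M T L).
Proof.
move=> skewE skewd stE st0 sL sM M0 fL sML.
rewrite -(@tabsum_growth _ _ _ K.+1 T) //.
exact: (SQ_tabsum skewE skewd fL stE st0).
Qed.

Lemma growth_self m t : (0 < m)%N -> G [:: m] t [:: m] = 1.
Proof.
move=> m0; elim: t => [|t IH]; first by rewrite /growth /= m0 eqxx.
rewrite growthS IH; case: ifP => [/andP[]|_]; last by rewrite addr0.
rewrite inE => /eqP mE _; rewrite (@growth_not_sub _ _ _ _ _ _ 0%N) ?mulr0 ?addr0 //.
  by case=> //= -[].
by rewrite /= -mE eqxx.
Qed.

Lemma nth_row_entries i j l k : (k < l)%N ->
  nth 0%N (row_entries a i j l) k = a (j + k - i)%N.
Proof. by move=> kl; rewrite (nth_map 0%N) ?size_iota // nth_iota. Qed.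

Lemma SQ_pair i j p q : (q < p)%N -> (p <= K)%N ->
    (forall k, (k < p)%N -> (0 < a k)%N) ->
  eq_below N (SQ (tab [:: p; q] [:: row_entries a i i p; row_entries a j j q]))
    (G [::] T [:: p; q]).
Proof.
move=> qp pK a0.
have tabE (b : SDskew [:: p; q] [::]) :
    tab [:: p; q] [:: row_entries a i i p; row_entries a j j q] b =
      a ((val b).2 - (val b).1)%N /\ ((val b).2 - (val b).1 < p)%N.
  rewrite ffunE; case: b => -[x y] xy /=.
  have : in_skew [:: p; q] [::] x y by rewrite -mem_SDskew.
  rewrite /in_skew nth_nil; case: x {xy} => [|[|x]] /= xy.
  - by rewrite nth_row_entries; [split; [congr a; lia|lia]|lia].
  - by rewrite nth_row_entries; [split; [congr a; lia|lia]|lia].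
  by move: xy; rewrite nth_nil; lia.
apply: (@SQ_growth _ _ _ _ 0%N) => //.
- by move=> x y; rewrite addn0 mem_SDskew.
- by move=> b; rewrite addn0 (tabE b).1.
- by move=> b; rewrite (tabE b).1 a0 // (tabE b).2.
- by case=> [|[|k]] //=; lia.
- by case=> [|[|k]] //=; rewrite ?nth_nil; lia.
by move=> k; rewrite nth_nil.
Qed.

Lemma SQ_row i l m : (0 < m)%N -> (m < l)%N -> (l <= K)%N ->
    (forall k, (k < l)%N -> (0 < a k)%N) ->
  eq_below N (SQrow (row_entries a i (i + m) (l - m))) (G [:: m] T [:: l]).
Proof.
move=> m0 ml lK a0; set x := row_entries _ _ _ _.
have sx : size x = (l - m)%N by rewrite size_map size_iota.
have skewE u v : ((u, v) \in SDskew [:: size x] [::]) =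
    in_skew [:: l] [:: m] u (v + m).
  rewrite mem_SDskew /in_skew sx nth_nil; case: u => [|u] /=; first by lia.
  by rewrite !nth_nil; lia.
have tabE (b : SDskew [:: size x] [::]) :
    tab [:: size x] [:: x] b =
      a ((val b).2 + m - (val b).1)%N /\ ((val b).2 + m - (val b).1 < l)%N.
  rewrite ffunE; case: b => -[u v] uv /=.
  have : in_skew [:: l] [:: m] u (v + m) by rewrite -skewE.
  rewrite /in_skew; case: u {uv} => [|u] /= uv.
    by rewrite nth_row_entries; [split; [congr a; lia|lia]|lia].
  by move: uv; rewrite !nth_nil; lia.
apply: (@SQ_growth _ _ _ _ m) => //.
- by move=> u v; rewrite /in_skew; case: u => [|u] /=; rewrite ?nth_nil; lia.
- by move=> b; rewrite (tabE b).1.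
- by move=> b; rewrite (tabE b).1 a0 // (tabE b).2.
- by case=> [|k] //=; rewrite nth_nil.
- by case=> [|k] //=; rewrite nth_nil.
- by rewrite inE eq_sym -lt0n.
- by case=> [|k] //=; rewrite ?nth_nil; lia.
by case=> [|k] //=; rewrite ?nth_nil //; lia.
Qed.

End Entries.

Theorem theorem10p5 (r s n : nat) (lam : r.-tuple nat) (mu : s.-tuple nat)
    (lam_strict : sorted gtn lam)
    (mu_strict : sorted gtn mu) (mu_gt0 : forall j, (0 < tnth mu j)%N)
    (mu_le_lam : (SD mu `<=` SD lam)%fset)
    (rs_even : (r + s)%N = n.*2)
    (a : nat -> nat) (a_gt0 : forall k, (k < nth 0%N lam 0)%N -> (0 < a k)%N)
    (st : ST lam mu nat)
    (st_diag : forall b, st b = a ((val b).2 - (val b).1)%N) :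
  SQ st = pf (castmx (rs_even, rs_even)
                (block_mx (Mmx lam a) (Hmx lam mu a) 0 0)).
Proof.
(* A grid of size K + 1 contains the diagrams of lam and of all the entries. *)
apply: eq_belowP => N; pose K := (r + nth 0 lam 0)%N.
pose G := growth_entry (rank_content K)
  (fun v => fps_var int (rank_letter K v)./2 ^+ a (rank_content K v))
  (N.*2 * K.+1)%N.
have slam := strict_parts_sorted lam_strict.
have lam_le i : (nth 0 lam i <= nth 0 lam 0)%N.
  by have := strict_parts_sub slam (leq0n i); lia.
have mu0 : 0%N \notin mu by apply/negP => /tnthP[j j0]; have := mu_gt0 j; rewrite -j0.
have fits_lam : fits K.+1 lam.
  move=> i i0; have ir : (i < r)%N.
    by rewrite -(size_tuple lam) ltnNge; apply: contraL i0 => /(nth_default 0%N)->.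
  by have := lam_le i; rewrite /K; lia.
have sub_mu : subparts mu lam.
  move=> i; have [->//|i0] := posnP (nth 0%N mu i).
  have : (i, (i + (nth 0 mu i).-1)%N) \in SD lam.
    by apply: (fsubsetP mu_le_lam); rewrite mem_SD; lia.
  by rewrite mem_SD; lia.
have st_gt0 b : (0 < st b)%N.
  rewrite st_diag a_gt0 //; move: (valP b); case: (val b) => x y /=.
  by rewrite mem_SDskew /in_skew; have := lam_le x; lia.
pose l := indices lam mu.
have sl : size l = n.*2 by rewrite size_cat !size_map size_rev !size_tuple.
move=> m mN; rewrite (@SQ_growth K N a _ _ lam mu 0) //; last first.
- exact: strict_parts_sorted.
- by move=> b; rewrite addn0.
- by move=> i j; rewrite addn0 mem_SDskew.
rewrite (@growth_pfs _ _ _ n _ _ _ lam_strict mu_strict mu0); last by rewrite !size_tuple.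
pose B : 'M_n.*2 := \matrix_(i, j) G (nth (inl 0%N) l i) (nth (inl 0%N) l j).
rewrite -(@pf_pfs _ _ (inl 0%N) _ _ _ B sl) => [|i j]; last by rewrite mxE.
move: m mN; apply: eq_below_pf => i j; apply: eq_below_sym; rewrite mxE castmxE /=.
have nth_inl (k : 'I_r) : nth (inl 0%N) l k = inl (tnth lam k).
  by rewrite nth_cat size_map size_tuple ltn_ord (nth_map 0%N) ?size_tuple // -tnth_nth.
have nth_inr (k : 'I_s) : nth (inl 0%N) l (r + k) = inr (tnth mu (rev_ord k)).
  rewrite nth_cat size_map size_tuple ltnNge leq_addr /= addKn.
  rewrite (nth_map 0%N) ?size_rev ?size_tuple // nth_rev ?size_tuple //.
  by rewrite (tnth_nth 0%N).
have lam_lt (i' j' : 'I_r) : (tnth lam j' < tnth lam i')%N = (i' < j')%N.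
  rewrite !(tnth_nth 0%N); have [ij|ji] := ltnP i' j'.
    have gtr : transitive gtn by apply: rev_trans ltn_trans.
    by apply: (sorted_ltn_nth gtr 0%N lam_strict _ _ _ _ ij);
      rewrite inE size_tuple ltn_ord.
  by have := strict_parts_sub slam ji; lia.
have lam_leK (i' : 'I_r) : (tnth lam i' <= K)%N.
  by have := lam_le i'; rewrite (tnth_nth 0%N) /K; lia.
rewrite -[nat_of_ord i]/(nat_of_ord (cast_ord (esym rs_even) i)).
rewrite -[nat_of_ord j]/(nat_of_ord (cast_ord (esym rs_even) j)).
move: (cast_ord _ i) (cast_ord _ j) => {}i {}j.
rewrite -(fintype.splitK i) -(fintype.splitK j).
case: (fintype.split i) => {}i; case: (fintype.split j) => {}j.
- rewrite block_mxEul mxE /= !nth_inl /G /growth_entry lam_lt.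
  case: ifP => // ij; apply: SQ_pair => [||k kl]; first by rewrite lam_lt.
    exact: lam_leK.
  by apply: a_gt0; apply: leq_trans kl _; rewrite (tnth_nth 0%N).
- rewrite block_mxEur mxE /= nth_inl nth_inr /G /growth_entry.
  set p := tnth lam i; set q := tnth mu _; have q0 : (0 < q)%N by apply: mu_gt0.
  have sp : strict_parts [:: p] by case=> [|k] //=; rewrite nth_nil.
  case: ltngtP => [pq|qp|->]; last by rewrite growth_self.
    by rewrite (@growth_not_sub _ _ _ _ _ _ 0%N).
  apply: SQ_row => //; first exact: lam_leK.
  by move=> k kl; apply: a_gt0; apply: leq_trans kl _; rewrite /p (tnth_nth 0%N).
- by rewrite block_mxEdl mxE /= nth_inr nth_inl.
by rewrite block_mxEdr mxE /= !nth_inr.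
Qed.
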